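(* Let $K$ be an algebraically closed field of characteristic $0$ and let $C\subset\mathbb{P}^2$ be the Fermat curve $X^d+Y^d+Z^d=0$ over $K$ of degree $d\ge 4$. Then $$\langle G_2(C),G_d(C)\rangle=\mathrm{Aut}(C).$$
   Context: For $P\in\mathbb{P}^2$, $\pi_P:C\dashrightarrow\mathbb{P}^1$ is the projection from $P$, and $G[P]=\{\tau\in\mathrm{Bir}(C)\mid \pi_P\circ\tau=\pi_P\}$. $P$ is called quasi-Galois if $|G[P]|\ge 2$. For smooth $C$ and $n\ge 2$, $G_n(C)=\langle G[P]\mid P\in\mathbb{P}^2 \text{ quasi-Galois with } |G[P]|=n\rangle\subset\mathrm{Aut}(C)$ is the subgroup generated by all these groups $G[P]$. $\langle G_2(C),G_d(C)\rangle$ is the subgroup of $\mathrm{Aut}(C)$ generated by $G_2(C)$ and $G_d(C)$. *)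

(* Defs.v *)
From HB Require Import structures.
From mathcomp Require Import all_boot all_order all_algebra.
From mathcomp Require Import mpoly.

Set Implicit Arguments.
Unset Strict Implicit.
Unset Printing Implicit Defensive.

Import GRing.Theory.
Local Open Scope ring_scope.

(* Points of P^2 are represented by nonzero row vectors v : 'rV[K]_3, and
   every notion below depends only on the class of v up to scaling.
   F is a ternary form whose zero locus C is an irreducible plane curve. *)
Section PlaneCurve.
Variables (K : closedFieldType) (F : {mpoly K[3]}).

Definition on_curve (v : 'rV[K]_3) : Prop := v != 0 /\ F.@[v 0] = 0.

Definition zero_on_curve (p : {mpoly K[3]}) : Prop :=
  forall v, on_curve v -> p.@[v 0] = 0.

(* A rational map C --> P^(n-1) is represented by n forms of a common degree,
   not all vanishing identically on C; two representatives define the same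
   rational map when all their 2x2 minors vanish on C. *)
Definition is_ratmap n (phi : n.-tuple {mpoly K[3]}) : Prop :=
  (exists e : nat, forall i, tnth phi i \is e.-homog)
  /\ (exists i, ~ zero_on_curve (tnth phi i)).

Definition rat_eq n (phi psi : n.-tuple {mpoly K[3]}) : Prop :=
  [/\ is_ratmap phi, is_ratmap psi
    & forall i j, zero_on_curve
        (tnth phi i * tnth psi j - tnth phi j * tnth psi i)].

(* phi o tau, for tau a rational map from C to P^2 *)
Definition rat_comp n (phi : n.-tuple {mpoly K[3]})
    (tau : 3.-tuple {mpoly K[3]}) : n.-tuple {mpoly K[3]} :=
  [tuple tnth phi i \mPo tau | i < n].

Definition rat_id : 3.-tuple {mpoly K[3]} := [tuple 'X_i | i < 3].

Definition is_selfmap (tau : 3.-tuple {mpoly K[3]}) : Prop :=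
  is_ratmap tau /\ zero_on_curve (F \mPo tau).

Definition mutually_inverse (tau sigma : 3.-tuple {mpoly K[3]}) : Prop :=
  [/\ is_selfmap tau, is_selfmap sigma,
      rat_eq (rat_comp tau sigma) rat_id & rat_eq (rat_comp sigma tau) rat_id].

(* Bir(C), as a predicate on representatives; equality in Bir(C) is rat_eq. *)
Definition Bir_curve (tau : 3.-tuple {mpoly K[3]}) : Prop :=
  exists sigma, mutually_inverse tau sigma.

(* The representative may depend on the point. *)
Definition regular (tau : 3.-tuple {mpoly K[3]}) : Prop :=
  forall v, on_curve v ->
    exists2 phi, rat_eq phi tau & exists i, (tnth phi i).@[v 0] != 0.

Definition Aut_curve (tau : 3.-tuple {mpoly K[3]}) : Prop :=
  exists sigma, [/\ mutually_inverse tau sigma, regular tau & regular sigma].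

(* The map v |-> v *m A, given by two linear forms.  When A has rank 2 and
   P *m A = 0 this is the projection from P, for some choice of coordinates
   on the P^1 of lines through P. *)
Definition linear_map (A : 'M[K]_(3, 2)) : 2.-tuple {mpoly K[3]} :=
  [tuple \sum_(i < 3) A i j *: 'X_i | j < 2].

Definition is_projection_from (P : 'rV[K]_3) (A : 'M[K]_(3, 2)) : Prop :=
  \rank A = 2%N /\ P *m A = 0.

(* G[P]; the condition does not depend on the choice of A. *)
Definition galois_at (P : 'rV[K]_3) (tau : 3.-tuple {mpoly K[3]}) : Prop :=
  Bir_curve tau /\
  forall A, is_projection_from P A ->
    rat_eq (rat_comp (linear_map A) tau) (linear_map A).

(* S has exactly (resp. at least) n elements, counted up to rat_eq. *)
Definition has_card (S : 3.-tuple {mpoly K[3]} -> Prop) (n : nat) : Prop :=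
  exists f : 'I_n -> 3.-tuple {mpoly K[3]},
    [/\ forall i, S (f i), forall i j, rat_eq (f i) (f j) -> i = j
      & forall tau, S tau -> exists i, rat_eq tau (f i)].

Definition card_ge (S : 3.-tuple {mpoly K[3]} -> Prop) (n : nat) : Prop :=
  exists f : 'I_n -> 3.-tuple {mpoly K[3]},
    (forall i, S (f i)) /\ (forall i j, rat_eq (f i) (f j) -> i = j).

Definition quasi_galois (P : 'rV[K]_3) : Prop := card_ge (galois_at P) 2.

(* The subgroup of Bir(C) generated by a subset S of Bir(C). *)
Inductive generated (S : 3.-tuple {mpoly K[3]} -> Prop) :
    3.-tuple {mpoly K[3]} -> Prop :=
| gen_in tau of S tau : generated S tau
| gen_id : generated S rat_id
| gen_comp tau sigma of generated S tau & generated S sigma :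
    generated S (rat_comp tau sigma)
| gen_inv tau sigma of generated S tau & mutually_inverse tau sigma :
    generated S sigma
| gen_eq tau sigma of generated S tau & rat_eq tau sigma :
    generated S sigma.

(* G_n(C), for C smooth and 2 <= n *)
Definition G_curve (n : nat) : 3.-tuple {mpoly K[3]} -> Prop :=
  generated (fun tau => exists P : 'rV[K]_3,
    [/\ P != 0, quasi_galois P, has_card (galois_at P) n & galois_at P tau]).

End PlaneCurve.

Definition fermat (K : closedFieldType) (d : nat) : {mpoly K[3]} :=
  \sum_(i < 3) 'X_i ^+ d.

(* Main.v *)
(* Let L = K(x, y) with x^d + y^d + 1 = 0 be the function field of the Fermat curve C; a
   rational map from C is studied through its values at the generic point (x : y : 1).

   The main point is that a birational self-map tau of C is given by a matrix. Pullback by tau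
   preserves holomorphic differentials, which are the forms of degree m = d - 3 times
   dX / Y^(d-1). Hence there is J in L such that (g o tau) J is a form of degree m on C for
   every form g of degree m, and g |-> (g o tau) J is bijective. Holomorphy is tested in the
   local rings of C, which are discrete valuation rings with explicit uniformizers. Bijectivity
   forces the images of the d points of C on the line X = 0 to lie on a line alpha, so that
   (alpha o tau) J / X has the same property in degree m - 1, and by descent one reaches m = 1.

   A linear automorphism of X^d + Y^d + Z^d is monomial, by comparing mixed second derivatives.
   Now G[P] can be computed: for a vertex P of the coordinate triangle it consists of the d
   homologies multiplying one coordinate by a d-th root of unity, and for P = e_i - e_j it
   consists of the identity and the exchange of two coordinates. These generate the monomial
   group. *)

Require Import Defs.
From mathcomp Require Import all_boot all_order all_fingroup all_algebra all_field.
From mathcomp Require Import ring.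
From mathcomp Require Import mpoly.
From Stdlib Require Import Classical ClassicalEpsilon.
(* again, since [rat.rat_eq] now shadows [Defs.rat_eq] *)
Require Import Defs.

Set Implicit Arguments.
Unset Strict Implicit.
Unset Printing Implicit Defensive.

Import GRing.Theory.
Local Open Scope ring_scope.

(** * The function field of the Fermat curve *)

(** A birational map may be given by forms of any degree, so linear algebra does not apply to it
    directly. Holomorphic differentials form a finite-dimensional space which it must preserve, and
    this takes the place of genus and Riemann-Roch: pullback is injective there, hence bijective. By
    itself this only shows that [tau] preserves the class of (d - 3)H, where H is a line section; as
    the class group has torsion, one cannot simply divide by d - 3. The descent carries out this
    division one degree at a time. The line X = 0 carries enough points of C for it in every degree
    up to d - 3, where it starts, and d >= 4 makes this degree positive.

    Local rings are set up in one affine chart only. Since 1/x and y/x satisfy the same equation as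
    x and y, all results on a chart also hold at the points at infinity, where regularity becomes a
    bound on degrees. A form of degree less than d vanishing at the generic point is zero; this
    turns identities on C into identities of polynomials. *)

Lemma fraction_tofracP (R : idomainType) (w : {fraction R}) :
  exists2 uv : R * R, uv.2 != 0 & w = tofrac uv.1 / tofrac uv.2.
Proof.
elim/quotW: w => r; exists (\n_r, \d_r) => /=; first exact: denom_ratioP.
apply: (@mulIf _ (tofrac \d_r)); first by rewrite tofrac_eq0 denom_ratioP.
rewrite divfK ?tofrac_eq0 ?denom_ratioP //.
rewrite -[_ * _]/(FracField.mul _ _); unlock FracField.tofrac.
rewrite -FracField.pi_mul; apply/eqmodP; rewrite /= FracField.equivfE /FracField.mulf.
by rewrite !numden_Ratio ?mulf_neq0 ?denom_ratioP ?oner_neq0 // !mulr1 mulrC.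
Qed.

(* If [q] is a factor of degree [n] and [M] its companion matrix, then [M ^ d = a], hence
   [(det M) ^ d = a ^ n], and comparing orders at [z] gives [d %| n]. *)
Lemma binomial_irreducible (K : fieldType) (a : {poly K}) (z : K) (d : nat) :
  (0 < d)%N -> a != 0 -> mup z a = 1%N ->
  irreducible_poly ('X^d - (tofrac a)%:P : {poly {fraction {poly K}}}).
Proof.
move=> d_gt0 a_neq0 mu_a; split; first by rewrite size_XnsubC.
move=> q size_q q_dvd.
have q_neq0 : q != 0.
  by apply: contraTneq q_dvd => ->; rewrite dvd0p -size_poly_eq0 size_XnsubC.
wlog q_monic : q size_q q_dvd q_neq0 / q \is monic.
  move=> hwlog; have lc0 : (lead_coef q)^-1 != 0 by rewrite invr_eq0 lead_coef_eq0.
  have := hwlog ((lead_coef q)^-1 *: q); rewrite size_scale // dvdpZl // ?(eqp_ltrans (eqp_scale _ _)) // scaler_eq0.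
  rewrite negb_or lc0; apply => //.
  by rewrite monicE lead_coefZ mulVf ?lead_coef_eq0.
have hM := companionmxK q_monic.
have nE : size q = (size q).-1.+1 by rewrite (polySpred q_neq0).
have n_gt0 : (0 < (size q).-1)%N by move: nE size_q => ->; case: _.-1.
have [n nE'] : exists n, (size q).-1 = n.+1 by exists (size q).-1.-1; rewrite prednK.
move: hM; move: (companionmx q); rewrite nE' => M hM.
have MX : M ^+ d = (tofrac a)%:M.
  have: horner_mx M ('X^d - (tofrac a)%:P) = 0.
    case/dvdpP: q_dvd => r ->.
    by rewrite rmorphM /= -hM Cayley_Hamilton mulr0.
  by rewrite rmorphB /= rmorphXn /= horner_mx_X horner_mx_C => /eqP; rewrite subr_eq0 => /eqP.
have detX : (\det M) ^+ d = (tofrac a) ^+ n.+1.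
  rewrite -(det_scalar n.+1 (tofrac a)) -MX.
  by elim: (d) => [|e IH]; rewrite ?expr0 ?det1 // !exprS det_mulmx IH.
have [[u v] /= v0 uvE] := fraction_tofracP (\det M).
have uvX : u ^+ d = a ^+ n.+1 * v ^+ d.
  apply/eqP; rewrite -tofrac_eq !rmorphM !rmorphXn /= -detX uvE exprMn exprVn mulfVK //.
  by rewrite expf_neq0 // tofrac_eq0.
have u0 : u != 0.
  have: u ^+ d != 0 by rewrite uvX mulf_neq0 ?expf_neq0.
  by rewrite expf_eq0 d_gt0.
have mupX (p : {poly K}) e : p != 0 -> mup z (p ^+ e) = (e * mup z p)%N.
  move=> p0; elim: e => [|e IH]; first by rewrite expr0 mupNroot // root1.
  by rewrite exprS mupM ?expf_neq0 // IH mulSn.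
move/(congr1 (mup z)): uvX; rewrite mupM ?expf_neq0 // !mupX // mu_a muln1 => hmu.
have dn : (d %| n.+1)%N by rewrite -(dvdn_addl _ (dvdn_mulr (mup z v) (dvdnn d))) -hmu dvdn_mulr.
have := dvdp_leq _ q_dvd; rewrite -size_poly_eq0 size_XnsubC // => /(_ isT).
rewrite nE nE' ltnS => nd.
rewrite -(dvdp_size_eqp q_dvd) size_XnsubC // nE nE' eqSS.
by rewrite eqn_leq nd dvdn_leq.
Qed.
Lemma fraction_common_denominator (R : idomainType) (q : {poly {fraction R}}) :
  exists2 c : R, c != 0 & exists P : {poly R}, tofrac c *: q = map_poly (@tofrac R) P.
Proof.
elim/poly_ind: q => [|q e [c c0 [P hP]]].
  by exists 1; rewrite ?oner_neq0 //; exists 0; rewrite scaler0 rmorph0.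
have [[u v] /= v0 ->] := fraction_tofracP e.
exists (c * v); first by rewrite mulf_neq0.
exists (v *: P * 'X + (c * u)%:P).
have -> : map_poly (@tofrac R) (v *: P * 'X + (c * u)%:P)
    = (tofrac v * tofrac c)%:P * q * 'X + (tofrac c * tofrac u)%:P.
  rewrite rmorphD /= (rmorphM (map_poly (@tofrac R))) /= map_polyX map_polyZ /= -hP map_polyC.
  by rewrite scalerA mul_polyC /= rmorphM.
rewrite rmorphM -mul_polyC mulrDr mulrA (mulrC (tofrac v)); congr (_ + _).
by rewrite -polyCM -mulrA [tofrac v * _]mulrC divfK // tofrac_eq0.
Qed.

Section Evaluation.
Variables (K S : comNzRingType) (f : {rmorphism K -> S}) (x y : S).

(* Value at [(x, y)] of a polynomial in [Y] whose coefficients are polynomials in [X]. *)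
Definition ev2 : {poly {poly K}} -> S :=
  horner_eval y \o map_poly (horner_eval x \o map_poly f).

Lemma ev2_0 : ev2 0 = 0. Proof. by rewrite /ev2 /= !rmorph0. Qed.
Lemma ev2_1 : ev2 1 = 1. Proof. by rewrite /ev2 /= !rmorph1. Qed.
Lemma ev2D P Q : ev2 (P + Q) = ev2 P + ev2 Q. Proof. by rewrite /ev2 /= !rmorphD. Qed.
Lemma ev2N P : ev2 (- P) = - ev2 P. Proof. by rewrite /ev2 /= !rmorphN. Qed.
Lemma ev2B P Q : ev2 (P - Q) = ev2 P - ev2 Q. Proof. by rewrite /ev2 /= !rmorphB. Qed.
Lemma ev2M P Q : ev2 (P * Q) = ev2 P * ev2 Q. Proof. by rewrite /ev2 /= !rmorphM. Qed.
Lemma ev2Xn P n : ev2 (P ^+ n) = ev2 P ^+ n. Proof. by rewrite /ev2 /= !rmorphXn. Qed.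

Lemma ev2_sum I r (P : pred I) F :
  ev2 (\sum_(i <- r | P i) F i) = \sum_(i <- r | P i) ev2 (F i).
Proof. exact: (big_morph ev2 ev2D ev2_0). Qed.

Lemma ev2C c : ev2 c%:P = (map_poly f c).[x].
Proof. by rewrite /ev2 /= map_polyC /= /horner_eval hornerC. Qed.

Lemma ev2X : ev2 'X = y.
Proof. by rewrite /ev2 /= map_polyX /horner_eval hornerX. Qed.

Lemma ev2CX : ev2 'X%:P = x.
Proof. by rewrite ev2C map_polyX hornerX. Qed.

Lemma ev2CC c : ev2 c%:P%:P = f c.
Proof. by rewrite ev2C map_polyC hornerC. Qed.

Lemma ev2E n (P : {poly {poly K}}) : (size P <= n)%N ->
  ev2 P = \sum_(i < n) (map_poly f P`_i).[x] * y ^+ i.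
Proof.
move=> hn; rewrite /ev2 /= /horner_eval (horner_coef_wide _ (leq_trans (size_poly _ _) hn)).
apply: eq_bigr => i _; rewrite coef_poly; case: ltnP => // h.
by rewrite nth_default // rmorph0 horner0.
Qed.

End Evaluation.

(** Monic in Y over K[X], so that division with remainder gives representatives of degree less than
    [d] in Y. *)
Definition affine_fermat (K : comNzRingType) (d : nat) : {poly {poly K}} :=
  'X^d + ('X^d + 1)%:P.

Lemma ev2_affine_fermat (K S : comNzRingType) (f : {rmorphism K -> S}) x y d :
  ev2 f x y (affine_fermat K d) = y ^+ d + (x ^+ d + 1).
Proof.
by rewrite ev2D ev2Xn ev2X ev2C rmorphD rmorph1 /= map_polyXn hornerD hornerXn hornerC.
Qed.

Lemma size_affine_fermat (K : comNzRingType) d : (0 < d)%N ->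
  size (affine_fermat K d) = d.+1.
Proof.
move=> d0; rewrite size_polyDl size_polyXn //.
by rewrite (leq_ltn_trans (size_polyC_leq1 _)).
Qed.

Lemma monic_affine_fermat (K : comNzRingType) d : (0 < d)%N ->
  affine_fermat K d \is monic.
Proof.
move=> d0; rewrite monicE lead_coefDl ?lead_coefXn // size_polyXn.
by rewrite (leq_ltn_trans (size_polyC_leq1 _)).
Qed.

(* [x] is transcendental over [K] and [1, y, .., y ^ (d - 1)] is a basis of [L] over [K(x)]. *)
Record fermat_chart (K : closedFieldType) (L : fieldType) (f : {rmorphism K -> L})
    (d : nat) (x y : L) : Prop := FermatChart {
  chart_eq : x ^+ d + y ^+ d + 1 = 0;
  chart_free : forall P : {poly {poly K}}, (size P <= d)%N -> ev2 f x y P = 0 -> P = 0;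
  chart_span : forall w, exists (c : {poly K}) (P : {poly {poly K}}), [/\ c != 0, (size P <= d)%N
    & w * (map_poly f c).[x] = ev2 f x y P] }.

Lemma natr_neq0_pchar0 (K : fieldType) (charK : [pchar K] =i pred0) n :
  (0 < n)%N -> n%:R != 0 :> K.
Proof. by move/pcharf0P: charK => ->; rewrite -lt0n. Qed.

(** In characteristic zero the derivative d X^(d-1) vanishes at most at 0, which is no root of X^d +
    1. A simple root is what the irreducibility criterion for Y^d = - (X^d + 1) asks for. *)
Lemma mup_XnD1 (K : closedFieldType) (charK : [pchar K] =i pred0) d (z : K) :
  (0 < d)%N -> z ^+ d + 1 = 0 -> mup z (- ('X^d + 1) : {poly K}) = 1%N.
Proof.
move=> d0 hz.
have sz : size ('X^d + 1 : {poly K}) = d.+1 by rewrite size_XnaddC.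
have p0 : - ('X^d + 1 : {poly K}) != 0 by rewrite oppr_eq0 -size_poly_eq0 sz.
apply/eqP; rewrite eqn_leq mup_leq // mup_geq // expr1 dvdp_XsubCl /root hornerN hornerD.
rewrite hornerXn hornerC hz oppr0 eqxx andbT.
apply/negP => /dvdpP [q /(congr1 (fun p => p^`().[z]))].
rewrite derivN derivD derivXn derivC addr0 hornerN hornerMn hornerXn derivM exprS expr1.
rewrite derivM hornerD !hornerM hornerXsubC hornerD !hornerM hornerXsubC subrr !(mulr0, mul0r, addr0) => /eqP.
rewrite oppr_eq0 -mulr_natr mulf_eq0 expf_eq0; case/orP => [/andP[_ /eqP z0]|].
  by move/eqP: hz; rewrite z0 expr0n gtn_eqF // add0r oner_eq0.
by rewrite (negPf (natr_neq0_pchar0 charK d0)).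
Qed.

Lemma fermat_chart_exists (K : closedFieldType) (charK : [pchar K] =i pred0) d :
  (0 < d)%N ->
  exists (L : fieldType) (f : {rmorphism K -> L}) (x y : L), fermat_chart f d x y.
Proof.
move=> d0.
have [z hz] : exists z : K, z ^+ d + 1 = 0.
  have : size ('X^d + 1 : {poly K}) != 1%N by rewrite size_XnaddC // eqSS gtn_eqF.
  by case/closed_rootP => z /rootP; rewrite hornerD hornerXn hornerC; exists z.
have mu := mup_XnD1 charK d0 hz.
have a0 : - ('X^d + 1) != 0 :> {poly K} by rewrite oppr_eq0 -size_poly_eq0 size_XnaddC.
have [L dimL [y hy gen]] := irredp_FAdjoin (binomial_irreducible d0 a0 mu).
pose g : {rmorphism {poly K} -> L} := in_alg L \o @tofrac {poly K}.
pose f : {rmorphism K -> L} := g \o @polyC K.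
have gE c : (map_poly f c).[g 'X] = g c.
  rewrite /f map_poly_comp horner_map; congr (g _); exact: comp_polyXr.
have evE P : ev2 f (g 'X) y P = (map_poly (in_alg L) (map_poly (@tofrac _) P)).[y].
  rewrite /ev2 /= /horner_eval -map_poly_comp; congr horner; apply: eq_map_poly => c.
  exact: gE.
have size_toF P : size (map_poly (@tofrac {poly K}) P) = size P.
  by apply: size_map_inj_poly => [u v /eqP|]; rewrite ?tofrac_eq ?rmorph0 // => /eqP.
have deg : adjoin_degree 1 y = d.
  by have := dim_Fadjoin 1 y; rewrite gen dimL size_XnsubC // dimv1 muln1.
exists L, f, (g 'X), y; split.
- move: hy; rewrite rmorphB /= map_polyXn map_polyC rootE !hornerE /=.
  have -> : (tofrac (- ('X^d + 1)))%:A = - (g 'X ^+ d + 1) :> L.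
    by rewrite -[LHS]/(g _) rmorphN rmorphD rmorph1 rmorphXn.
  by rewrite opprK => /eqP <-; rewrite addrAC addrC addrA.
- move=> P sP; rewrite evE => /eqP rP.
  apply/eqP; apply: contraT => P0.
  have M0 : map_poly (in_alg L) (map_poly (@tofrac _) P) != 0.
    by rewrite map_poly_eq0 -size_poly_eq0 size_toF size_poly_eq0.
  have := dvdp_leq M0 (minPoly_dvdp (alg_polyOver 1 _) rP).
  by rewrite size_minPoly deg size_map_poly size_toF => /leq_trans/(_ sP); rewrite ltnn.
- move=> w.
  have : w \in <<1; y>>%VS by rewrite gen memvf.
  move/Fadjoin_poly_eq; have /polyOver1P [q hq] := Fadjoin_polyOver 1 y w => hw.
  have [c c0 [P hP]] := fraction_common_denominator q.
  exists c, P; split=> //.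
    rewrite -size_toF -hP size_scale ?tofrac_eq0 // -(size_map_poly (in_alg L)).
    by rewrite -hq -deg size_Fadjoin_poly.
  by rewrite evE -hP map_polyZ hornerZ gE -hq hw mulrC.
Qed.

(** * Exchange of affine charts *)

Definition rev_poly (K : comNzRingType) N (p : {poly K}) : {poly K} :=
  \poly_(k < N.+1) p`_(N - k).

Lemma horner_rev_poly (K : comNzRingType) (L : fieldType) (f : {rmorphism K -> L})
  N (p : {poly K}) (x : L) : (size p <= N.+1)%N -> x != 0 ->
  (map_poly f (rev_poly N p)).[x] = x ^+ N * (map_poly f p).[x^-1].
Proof.
move=> hp x0; rewrite (horner_coef_wide _ (leq_trans (size_poly _ _) (size_poly _ _))).
rewrite (horner_coef_wide _ (leq_trans (size_poly _ _) hp)) mulr_sumr.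
rewrite (reindex_inj rev_ord_inj) /=; apply: eq_bigr => i _.
have iN : (i <= N)%N by rewrite -ltnS.
rewrite !coef_map /= coef_poly ltnS subSS leq_subr subKn //.
by rewrite exprVn mulrCA -expfB_cond // (negPf x0).
Qed.

Lemma rev_poly_eq0 (K : comNzRingType) N (p : {poly K}) :
  (size p <= N.+1)%N -> rev_poly N p = 0 -> p = 0.
Proof.
move=> hp h; apply/polyP => k; rewrite coef0; case: (leqP k N) => kN.
  move/(congr1 (fun q : {poly K} => q`_(N - k))): h.
  by rewrite coef_poly ltnS leq_subr subKn // coef0.
by rewrite nth_default // (leq_trans hp).
Qed.

Section ChartFlip.
Variables (K : closedFieldType) (L : fieldType) (f : {rmorphism K -> L}) (d : nat).
Hypothesis d_gt0 : (0 < d)%N.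

(** The factor x^N clears the denominators of P(1/x, y/x): with N = M + d, the coefficient of y^i
    becomes x^(d-i) times a reversed polynomial of degree at most M. The last clause says that the
    result has total degree at most N, which later bounds the order of a pole at infinity. *)
Lemma ev2_flip (x y : L) (P : {poly {poly K}}) : x != 0 -> (size P <= d)%N ->
  exists N0, forall N, (N0 <= N)%N -> exists P' : {poly {poly K}},
    [/\ (size P' <= d)%N, ev2 f x y P' = x ^+ N * ev2 f x^-1 (y / x) P,
        P' = 0 -> P = 0 & forall i, (i < d)%N -> (size (P'`_i)%R + i <= N.+1)%N].
Proof.
move=> x0 sP; pose N1 := \max_(i < d) size (P`_i)%R.
have hN1 i : (size (P`_i)%R <= N1)%N.
  case: (ltnP i d) => [h|h]; first exact: (leq_bigmax (Ordinal h)).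
  by rewrite nth_default ?size_poly0 // (leq_trans sP).
exists (N1 + d)%N => N hN; pose M := (N - d)%N.
have NE : N = (M + d)%N by rewrite subnK // (leq_trans _ hN) // leq_addl.
have hM i : (size (P`_i)%R <= M.+1)%N.
  by apply: leq_trans (hN1 i) _; apply: leqW; rewrite /M leq_subRL ?(leq_trans _ hN) ?leq_addl // addnC.
exists (\poly_(i < d) (rev_poly M P`_i * 'X^(d - i))); split; first exact: size_poly.
  rewrite (ev2E _ _ _ (size_poly _ _)) (ev2E _ _ _ sP) mulr_sumr.
  apply: eq_bigr => i _; rewrite coef_poly ltn_ord rmorphM /= map_polyXn hornerM hornerXn.
  rewrite horner_rev_poly // NE exprD exprMn exprVn.
  have -> : x ^+ (d - i) = x ^+ d / x ^+ i by rewrite expfB_cond // (negPf x0) add0n ltnW.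
  by ring.
  move=> h; apply/polyP => i; rewrite coef0; case: (ltnP i d) => hi; last first.
    by rewrite nth_default // (leq_trans sP).
  move/(congr1 (fun q : {poly {poly K}} => q`_i)): h; rewrite coef_poly hi coef0 => /eqP.
  by rewrite mulf_eq0 expf_eq0 polyX_eq0 andbF orbF => /eqP/rev_poly_eq0; apply.
move=> i hi; rewrite coef_poly hi.
apply: (@leq_trans ((M.+1 + (d - i)) + i)); last by rewrite -addnA (subnK (ltnW hi)) NE addSn.
rewrite leq_add2r (leq_trans (size_polyMleq _ _)) // size_polyXn addnS /= leq_add2r.
exact: size_poly.
Qed.

Lemma chart_transcendental (x y : L) : fermat_chart f d x y ->
  forall c : {poly K}, c != 0 -> (map_poly f c).[x] != 0.
Proof.
case=> _ free _ c; apply: contra_neq => h.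
have := free c%:P; rewrite ev2C h => /(_ (leq_trans (size_polyC_leq1 _) d_gt0) erefl)/eqP.
by rewrite polyC_eq0 => /eqP.
Qed.

(** Division of x^d + y^d + 1 = 0 by x^d permutes the terms of the equation. The points of the
    projective curve with Z = 0 have X nonzero, so the two charts cover the curve. *)
Lemma chart_flip (x y : L) : fermat_chart f d x y -> fermat_chart f d x^-1 (y / x).
Proof.
move=> ch; have x0 : x != 0.
  by have := chart_transcendental ch (negbT (polyX_eq0 K)); rewrite map_polyX hornerX.
have [ceq free span] := ch; split.
- apply: (mulfI (expf_neq0 d x0)); rewrite mulr0 !mulrDr mulr1 -!exprMn divff //.
  by rewrite expr1n mulrCA divff // mulr1 -addrA addrC -[RHS]ceq [x ^+ d + _]addrC addrAC.
- move=> P sP hP; have [N0 /(_ N0 (leqnn _)) [P' [sP' eP' nP' _]]] := ev2_flip y x0 sP.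
  by apply/nP'/(free P' sP'); rewrite eP' hP mulr0.
- move=> w; have [c [P [c0 sP hw]]] := span w.
  have u0 : x^-1 != 0 by rewrite invr_eq0.
  have [N0 hN0] := ev2_flip (y / x) u0 sP.
  pose N := maxn N0 (size c).
  have [P' [sP' eP' _ _]] := hN0 N (leq_maxl _ _).
  have sc : (size c <= N.+1)%N by rewrite leqW // leq_maxr.
  exists (rev_poly N c), P'; split=> //.
    by apply: contra_neq c0 => /rev_poly_eq0; apply.
  by rewrite horner_rev_poly // eP' invrK mulfVK // -hw mulrCA.
Qed.

End ChartFlip.

(** * Local rings of the affine Fermat curve *)

Lemma XnsubC_roots (K : closedFieldType) (charK : [pchar K] =i pred0) d (a : K) :
  (0 < d)%N -> a != 0 ->
  exists s : seq K, [/\ size s = d, uniq s & forall z, (z \in s) = (z ^+ d == a)].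
Proof.
move=> d0 a0; have [s hs] := closed_field_poly_normal ('X^d - a%:P : {poly K}).
have mon : 'X^d - a%:P \is @monic K by rewrite monicXnsubC.
move: hs; rewrite (monicP mon) scale1r => hs; exists s; split.
- by apply: succn_inj; rewrite -(size_prod_XsubC s id) -hs size_XnsubC.
- rewrite -separable_prod_XsubC -hs separable_poly.unlock.
  apply/Pdiv.ClosedField.coprimepP => z.
  rewrite rootE !hornerE subr_eq0 => /eqP za.
  rewrite derivB derivXn derivC subr0 hornerMn hornerXn -mulr_natr.
  rewrite mulf_neq0 ?natr_neq0_pchar0 // expf_neq0 //.
  by apply: contra_neq a0 => z0; rewrite -za z0 expr0n gtn_eqF.
- by move=> z; rewrite -root_prod_XsubC -hs rootE !hornerE subr_eq0.
Qed.

Lemma poly_zero_closed (K : closedFieldType) (p : {poly K}) :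
  (forall z, p.[z] = 0) -> p = 0.
Proof.
move=> h; apply/eqP; apply: contraT => /closed_nonrootP [z].
by rewrite rootE h eqxx.
Qed.

Section Chart.
Variables (K : closedFieldType) (charK : [pchar K] =i pred0) (L : fieldType).
Variables (f : {rmorphism K -> L}) (d : nat) (d_gt1 : (1 < d)%N) (x y : L).
Hypothesis ch : fermat_chart f d x y.

Local Notation ev := (ev2 f x y).
Local Notation pt := (ev2 (idfun : {rmorphism K -> K})).
Local Notation oncurve x0 y0 := (x0 ^+ d + y0 ^+ d + 1 = 0).

Let d_gt0 : (0 < d)%N. Proof. exact: ltnW. Qed.

Lemma pt_horner x0 y0 P : pt x0 y0 P = (map_poly (horner_eval x0) P).[y0].
Proof.
rewrite /ev2 /= /horner_eval; congr horner; apply: eq_map_poly => c /=.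
by rewrite map_poly_id.
Qed.

Lemma ev_fermat : ev (affine_fermat K d) = 0.
Proof. by rewrite ev2_affine_fermat addrA [y ^+ d + _]addrC (chart_eq ch). Qed.

Lemma pt_fermat x0 y0 : oncurve x0 y0 -> pt x0 y0 (affine_fermat K d) = 0.
Proof. by move=> h; rewrite ev2_affine_fermat addrA [y0 ^+ d + _]addrC. Qed.

Lemma affine_fermat_divmod P : exists Q R : {poly {poly K}},
  P = Q * affine_fermat K d + R /\ (size R <= d)%N.
Proof.
exists (Pdiv.Ring.rdivp P (affine_fermat K d)), (Pdiv.Ring.rmodp P (affine_fermat K d)).
split; first exact/Pdiv.RingMonic.rdivp_eq/monic_affine_fermat.
rewrite -ltnS -(size_affine_fermat K d_gt0) Pdiv.Ring.ltn_rmodpN0 //.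
by rewrite -size_poly_eq0 size_affine_fermat.
Qed.

(** Modulo the monic equation the degree in Y is less than [d], where evaluation at the generic
    point is injective. Hence identities in [L] specialise to every point of the curve. *)
Lemma ev_eq0_dvd P : ev P = 0 -> exists Q, P = Q * affine_fermat K d.
Proof.
move=> h; have [Q [R [PE sR]]] := affine_fermat_divmod P; exists Q.
have R0 : ev R = 0 by rewrite -h PE ev2D ev2M ev_fermat mulr0 add0r.
by rewrite [LHS]PE (chart_free ch sR R0) addr0.
Qed.

Lemma ev_eq0_pt P x0 y0 : oncurve x0 y0 -> ev P = 0 -> pt x0 y0 P = 0.
Proof. by move=> h /ev_eq0_dvd [Q ->]; rewrite ev2M pt_fermat // mulr0. Qed.

Lemma ev_eq_pt (P Q : {poly {poly K}}) x0 y0 : oncurve x0 y0 -> ev P = ev Q -> pt x0 y0 P = pt x0 y0 Q.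
Proof.
by move=> h e; apply/eqP; rewrite -subr_eq0 -ev2B ev_eq0_pt // ev2B e subrr.
Qed.

(** A remainder of degree less than [d] in Y has [d] distinct zeros over each x0 with x0^d + 1
    nonzero, so its coefficients vanish at these x0; the factor X^d + 1 takes care of the other
    x0. *)
Lemma pt_eq0_ev P : (forall x0 y0, oncurve x0 y0 -> pt x0 y0 P = 0) -> ev P = 0.
Proof.
move=> h; have [Q [R [PE sR]]] := affine_fermat_divmod P.
suff R0 : R = 0 by rewrite PE R0 addr0 ev2M ev_fermat mulr0.
have RE0 x0 : x0 ^+ d + 1 != 0 -> map_poly (horner_eval x0) R = 0.
  move=> hx; have [|s [ss us ms]] := XnsubC_roots charK d_gt0 (a := - (x0 ^+ d + 1)).
    by rewrite oppr_eq0.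
  apply: (@roots_geq_poly_eq0 _ _ s) => //.
    apply/allP => z; rewrite ms => /eqP hz.
    have onz : oncurve x0 z by rewrite hz; ring.
    move: (h _ _ onz); rewrite PE ev2D ev2M pt_fermat // mulr0 add0r.
    by rewrite pt_horner rootE => ->.
  by rewrite ss (leq_trans (size_poly _ _)).
apply/polyP => i; rewrite coef0; apply/eqP.
have X0 : ('X^d + 1 : {poly K}) != 0 by rewrite -size_poly_eq0 size_XnaddC.
rewrite -(mulIr_eq0 _ (mulIf X0)); apply/eqP/poly_zero_closed => z.
rewrite hornerM !hornerE; have [->|hz] := eqVneq (z ^+ d + 1) 0; first by rewrite mulr0.
move/(congr1 (fun p : {poly K} => p`_i)): (RE0 z hz).
by rewrite coef0 coef_map_id0 ?/horner_eval ?horner0 // => ->; rewrite mul0r.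
Qed.

(** The graph of the residue map of the local ring at (x0, y0): membership and value are carried
    together. *)
Definition regular_at (x0 y0 : K) (w : L) (k : K) : Prop :=
  exists p q : {poly {poly K}},
    [/\ pt x0 y0 q != 0, w * ev q = ev p & k * pt x0 y0 q = pt x0 y0 p].

Section LocalRing.
Variables (x0 y0 : K) (on0 : oncurve x0 y0).

Lemma ev_neq0 P : pt x0 y0 P != 0 -> ev P != 0.
Proof. by apply: contra_neq; apply: ev_eq0_pt. Qed.

Lemma regular_at_ev p : regular_at x0 y0 (ev p) (pt x0 y0 p).
Proof. by exists p, 1; rewrite !ev2_1 !mulr1 oner_neq0. Qed.

Lemma regular_at_uniq w k k' :
  regular_at x0 y0 w k -> regular_at x0 y0 w k' -> k = k'.
Proof.
move=> [p [q [q0 hw hk]]] [p' [q' [q0' hw' hk']]].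
have e : ev (p * q') = ev (p' * q) by rewrite !ev2M -hw -hw'; ring.
have := ev_eq_pt on0 e; rewrite !ev2M -hk -hk' => h.
by apply: (mulIf q0); apply: (mulIf q0'); rewrite h; ring.
Qed.

Lemma regular_atD w w' k k' : regular_at x0 y0 w k -> regular_at x0 y0 w' k' ->
  regular_at x0 y0 (w + w') (k + k').
Proof.
move=> [p [q [q0 hw hk]]] [p' [q' [q0' hw' hk']]].
exists (p * q' + p' * q), (q * q'); rewrite !ev2D !ev2M mulf_neq0 //.
by rewrite -hw -hw' -hk -hk'; split=> //; ring.
Qed.

Lemma regular_atM w w' k k' : regular_at x0 y0 w k -> regular_at x0 y0 w' k' ->
  regular_at x0 y0 (w * w') (k * k').
Proof.
move=> [p [q [q0 hw hk]]] [p' [q' [q0' hw' hk']]].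
exists (p * p'), (q * q'); rewrite !ev2M mulf_neq0 //.
by rewrite -hw -hw' -hk -hk'; split=> //; ring.
Qed.

Lemma regular_at_const c : regular_at x0 y0 (f c) c.
Proof. by have := regular_at_ev c%:P%:P; rewrite !ev2CC. Qed.

Lemma regular_atX w k n : regular_at x0 y0 w k -> regular_at x0 y0 (w ^+ n) (k ^+ n).
Proof.
move=> h; elim: n => [|n IH]; last by rewrite !exprS; apply: regular_atM.
by rewrite !expr0 -(rmorph1 f); apply: regular_at_const.
Qed.

Lemma pt_eq0_decomp P : pt x0 y0 P = 0 -> exists (Q : {poly {poly K}}) (c : {poly K}),
  P = Q * ('X - y0%:P%:P) + (c * ('X - x0%:P))%:P.
Proof.
move=> hP; have /factor_theorem [c hc] : root P.[y0%:P] x0.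
  apply/rootP; rewrite -hP pt_horner -[y0 in RHS](hornerC y0 x0) -/(horner_eval x0 y0%:P).
  by rewrite horner_map.
have /factor_theorem [Q hQ] : root (P - P.[y0%:P]%:P) y0%:P.
  by rewrite rootE hornerD hornerN hornerC subrr.
by exists Q, c; rewrite -hc -hQ subrK.
Qed.

(** The quotients (X^d - x0^d) / (X - x0) and (Y^d - y0^d) / (Y - y0). Their values at the point, d
    x0^(d-1) and d y0^(d-1), are the partial derivatives of the equation there. *)
Let sX : {poly {poly K}} := (\sum_(i < d) 'X^(d.-1 - i) * x0%:P ^+ i)%:P.
Let sY : {poly {poly K}} := \sum_(i < d) 'X^(d.-1 - i) * y0%:P%:P ^+ i.

Let sum_diag (z : K) : \sum_(i < d) z ^+ (d.-1 - i) * z ^+ i = d%:R * z ^+ d.-1.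
Proof.
rewrite (eq_bigr (fun=> z ^+ d.-1)) => [|i _]; first by rewrite sumr_const card_ord mulr_natl.
by rewrite -exprD subnK // -ltnS prednK.
Qed.

Let evXsubC : ev ('X - x0%:P)%:P = x - f x0.
Proof. by rewrite polyCB ev2B ev2CX ev2CC. Qed.

Let evYsubC : ev ('X - y0%:P%:P) = y - f y0.
Proof. by rewrite ev2B ev2X ev2CC. Qed.

Let ev_sX : (x - f x0) * ev sX = x ^+ d - f x0 ^+ d.
Proof.
rewrite -evXsubC -ev2M -polyCM -subrXX polyCB !polyC_exp ev2B !ev2Xn.
by rewrite ev2CX ev2CC.
Qed.

Let ev_sY : (y - f y0) * ev sY = y ^+ d - f y0 ^+ d.
Proof. by rewrite -evYsubC -ev2M -subrXX ev2B !ev2Xn ev2X ev2CC. Qed.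

Let pt_sX : pt x0 y0 sX = d%:R * x0 ^+ d.-1.
Proof.
rewrite -sum_diag ev2C map_poly_id // horner_sum; apply: eq_bigr => i _.
by rewrite hornerM hornerXn -polyC_exp hornerC.
Qed.

Let pt_sY : pt x0 y0 sY = d%:R * y0 ^+ d.-1.
Proof.
by rewrite -sum_diag ev2_sum; apply: eq_bigr => i _; rewrite ev2M !ev2Xn ev2X ev2CC.
Qed.

(** Smoothness, made explicit by the relation (x - x0) [sX] = - (y - y0) [sY] on the curve. If y0 is
    nonzero, [sY] is a unit and X - x0 generates the maximal ideal; if y0 = 0, then x0 is nonzero,
    [sX] is a unit and Y generates it. The exponent [e] is the ramification index of the projection
    to the x-line: 1 in the first case, d in the second. *)
Lemma uniformizer : exists (t s u : {poly {poly K}}) (e : nat),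
  [/\ pt x0 y0 t = 0, ev t != 0, pt x0 y0 s != 0 /\ pt x0 y0 u != 0,
      (x - f x0) * ev s = ev t ^+ e * ev u &
      forall g, pt x0 y0 g = 0 -> exists s' g', pt x0 y0 s' != 0 /\ ev s' * ev g = ev t * ev g'].
Proof.
have fon0 : f x0 ^+ d + f y0 ^+ d + 1 = 0 by rewrite -!rmorphXn -!rmorphD -(rmorph1 f) -rmorphD on0 rmorph0.
have yE : y ^+ d = - (x ^+ d + 1).
  by apply: (addrI (x ^+ d + 1)); rewrite subrr -(chart_eq ch); ring.
have fyE : f y0 ^+ d = - (f x0 ^+ d + 1).
  by apply: (addrI (f x0 ^+ d + 1)); rewrite subrr -fon0; ring.
have evE Q (c : {poly K}) :
    ev (Q * ('X - y0%:P%:P) + (c * ('X - x0%:P))%:P) = ev Q * (y - f y0) + ev c%:P * (x - f x0).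
  by rewrite ev2D polyCM !ev2M polyCB !ev2B ev2X ev2CX !ev2CC.
have dK := natr_neq0_pchar0 charK d_gt0.
have [y00|y00] := eqVneq y0 0; last first.
  exists ('X - x0%:P)%:P, 1, 1, 1%N; rewrite !ev2_1 oner_neq0; split=> //.
  - by rewrite polyCB ev2B ev2CX ev2CC subrr.
  - by rewrite ev2C (chart_transcendental d_gt0 ch) // polyXsubC_eq0.
  - by rewrite polyCB ev2B ev2CX ev2CC.
  move=> g /pt_eq0_decomp [Q [c ->]]; exists sY, (sY * c%:P - sX * Q).
  rewrite pt_sY mulf_neq0 ?expf_neq0 //; split=> //.
  rewrite evE polyCB !ev2B ev2CX ev2CC !ev2M.
  transitivity ((y ^+ d - f y0 ^+ d) * ev Q + (x - f x0) * (ev sY * ev c%:P)); first by rewrite -ev_sY; ring.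
  have -> : y ^+ d - f y0 ^+ d = - (x ^+ d - f x0 ^+ d).
    by rewrite yE fyE; ring.
  by rewrite -ev_sX; ring.
have x00 : x0 != 0.
  apply: contra_eqN on0 => /eqP ->; rewrite y00 expr0n gtn_eqF // !add0r; exact: oner_neq0.
have hx : (x - f x0) * ev sX = - y ^+ d.
  have fx : f x0 ^+ d = -1.
    apply: (addIr 1); rewrite addNr; apply/eqP.
    by rewrite -oppr_eq0 -fyE y00 rmorph0 expr0n gtn_eqF.
  by rewrite ev_sX fx yE; ring.
exists 'X, sX, (-1), d; rewrite ev2X ev2N ev2_1 oppr_eq0 oner_neq0 ev2X; split=> //.
- apply/eqP => y0'; have X0 : 'X^d + 1 != 0 :> {poly K} by rewrite -size_poly_eq0 size_XnaddC.
  have /eqP := chart_transcendental d_gt0 ch X0; apply.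
  rewrite rmorphD /= map_polyXn rmorph1 hornerD hornerXn hornerC.
  by rewrite -(chart_eq ch) y0' expr0n gtn_eqF // addr0.
- by rewrite pt_sX mulf_neq0 ?expf_neq0.
- by rewrite hx ev2N ev2_1; ring.
move=> g /pt_eq0_decomp [Q [c ->]]; exists sX, (sX * Q - 'X^(d.-1) * c%:P).
rewrite pt_sX mulf_neq0 ?expf_neq0 //; split=> //.
rewrite evE y00 rmorph0 subr0 ev2B !ev2M ev2Xn ev2X mulrDr.
transitivity (ev sX * ev Q * y + (x - f x0) * ev sX * ev c%:P); first by ring.
by rewrite hx -[in LHS](prednK d_gt0) exprS; ring.
Qed.

(* [t] is a uniformizer at the point. A nonzero [g] is not divisible by all powers of [t],
   because it divides a nonzero polynomial [c] in [x], whose order at the point is finite. *)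
Lemma regular_or_inv w : (exists k, regular_at x0 y0 w k) \/ (exists k, regular_at x0 y0 w^-1 k).
Proof.
have [t [s [u [e [t0 evt0 [s0 u0] st tdiv]]]]] := uniformizer.
have order g : ev g != 0 -> exists n s1 g1,
    [/\ pt x0 y0 s1 != 0, pt x0 y0 g1 != 0 & ev s1 * ev g = ev t ^+ n * ev g1].
  move=> g0; apply: NNPP => hno.
  have step n : exists s1 g1, pt x0 y0 s1 != 0 /\ ev s1 * ev g = ev t ^+ n * ev g1.
    elim: n => [|n [s1 [g1 [s10 e1]]]]; first by exists 1, g; rewrite !ev2_1 oner_neq0.
    have /eqP g10 : pt x0 y0 g1 == 0.
      by apply: contraT => g10; case: hno; exists n, s1, g1.
    have [s2 [g2 [s20 e2]]] := tdiv _ g10.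
    exists (s1 * s2), g2; rewrite !ev2M mulf_neq0 //; split=> //.
    by rewrite exprSr -[RHS]mulrA -e2 mulrCA -e1; ring.
  have [c [A [c0 _ hA]]] := chart_span ch (ev g)^-1.
  have [n [c1 c10 cE]] := multiplicity_XsubC c x0.
  (* The order of c(x) at the point is e n, with n the multiplicity of x0 in c; one more power of
     [t] is impossible in its divisor g. *)
  have [s1 [g1 [s10 e1]]] := step (e * n).+1.
  rewrite c0 /= in c10.
  have hc : ev c%:P = ev A * ev g by rewrite -hA ev2C mulrAC mulVf // mul1r.
  have hcn : ev c%:P * ev s ^+ n = ev c1%:P * (ev t ^+ (e * n) * ev u ^+ n).
    rewrite cE polyCM polyC_exp polyCB ev2M ev2Xn ev2B ev2CX ev2CC -mulrA -exprMn st exprMn.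
    by rewrite -exprM.
  have : ev (s1 * c1%:P * u ^+ n) = ev (t * g1 * A * s ^+ n).
    apply: (mulIf (expf_neq0 (e * n) evt0)).
    transitivity (ev s1 * (ev c%:P * ev s ^+ n)); first by rewrite hcn !ev2M !ev2Xn; ring.
    transitivity (ev s1 * ev g * (ev A * ev s ^+ n)); first by rewrite hc; ring.
    by rewrite e1 !ev2M !ev2Xn exprS; ring.
  move/(ev_eq_pt on0); rewrite !ev2M !ev2Xn t0 !mul0r => /eqP.
  rewrite !mulf_eq0 (negPf s10) expf_eq0 (negPf u0) andbF orbF /=.
  by rewrite ev2C map_poly_id // -rootE (negPf c10).
have [->|w0] := eqVneq w 0.
  by left; exists 0; rewrite -(rmorph0 f); apply: regular_at_const.
have [c [p [c0 _ hp]]] := chart_span ch w.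
have evc0 : ev c%:P != 0 by rewrite ev2C (chart_transcendental d_gt0 ch).
have evp0 : ev p != 0 by rewrite -hp mulf_neq0 // (chart_transcendental d_gt0 ch).
have [n [s1 [g1 [s10 g10 e1]]]] := order _ evp0.
have [m [s2 [g2 [s20 g20 e2]]]] := order _ evc0.
have wE : w * (ev t ^+ m * ev g2 * ev s1) = ev t ^+ n * ev g1 * ev s2.
  by rewrite -e1 -e2 -hp ev2C; ring.
case: (leqP m n) => [mn|/ltnW nm].
  left; exists (pt x0 y0 (t ^+ (n - m) * g1 * s2) / pt x0 y0 (g2 * s1)).
  exists (t ^+ (n - m) * g1 * s2), (g2 * s1).
  have h : pt x0 y0 (g2 * s1) != 0 by rewrite ev2M mulf_neq0.
  split; rewrite ?mulfVK //; apply: (mulfI (expf_neq0 m evt0)).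
  transitivity (w * (ev t ^+ m * ev g2 * ev s1)); first by rewrite ev2M; ring.
  by rewrite wE !ev2M ev2Xn -[in LHS](subnK mn) exprD; ring.
right; exists (pt x0 y0 (t ^+ (m - n) * g2 * s1) / pt x0 y0 (g1 * s2)).
exists (t ^+ (m - n) * g2 * s1), (g1 * s2).
have h : pt x0 y0 (g1 * s2) != 0 by rewrite ev2M mulf_neq0.
split; rewrite ?mulfVK //; apply: (mulfI (expf_neq0 n evt0)); apply: (mulfI w0).
transitivity (ev t ^+ n * ev g1 * ev s2); first by rewrite ev2M (mulrCA (ev t ^+ n)) mulVKf // mulrA.
by rewrite -wE !ev2M ev2Xn -[in LHS](subnK nm) exprD; ring.
Qed.

End LocalRing.
End Chart.

(** * Globally regular functions and a derivation of the function field *)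

(** The cofactor of the gcd in F is not constant for degree reasons, and its roots are not roots of
    the cofactor in r. This finds a point where r vanishes to lower order than F, even in a ramified
    fibre, where F = Y^d. *)
Lemma gcdp_cofactor_root (K : closedFieldType) (r F : {poly K}) :
  r != 0 -> (size r < size F)%N -> exists (z : K) (r1 E g : {poly K}),
  [/\ r = r1 * g, F = E * g, g != 0, E.[z] = 0 & r1.[z] != 0].
Proof.
move=> r0 sr; have F0 : F != 0 by rewrite -size_poly_gt0 (leq_ltn_trans _ sr).
have g0 : gcdp r F != 0 by rewrite gcdp_eq0 negb_and r0.
have rE := divpK (dvdp_gcdl r F); have FE := divpK (dvdp_gcdr r F).
have : size (F %/ gcdp r F) != 1%N.
  apply: contraTneq sr => sE; rewrite -leqNgt -{1}FE size_mul //; last first.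
    by apply: contraNneq F0 => E0; rewrite -FE E0 mul0r.
  by rewrite sE dvdp_leq // dvdp_gcdl.
case/closed_rootP => z Ez; exists z, (r %/ gcdp r F), (F %/ gcdp r F), (gcdp r F).
split=> //; first exact/rootP.
have co := coprimep_div_gcd (_ : (r != 0) || (F != 0)).
rewrite coprimep_sym in co; apply: (Pdiv.ClosedField.coprimepP _ _ (co _)) => //.
by rewrite r0.
Qed.

Lemma polyC_root_factor (K : fieldType) (R : {poly {poly K}}) (z : K) :
  map_poly (horner_eval z) R = 0 ->
  exists2 R1, R = R1 * ('X - z%:P)%:P & size R1 = size R.
Proof.
move=> h; have /factor_theorem [S hS] : root (swapXY R) z%:P.
  by rewrite rootE horner_polyC swapXYK h.
have RE : R = swapXY S * ('X - z%:P)%:P.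
  by rewrite -[LHS]swapXYK hS rmorphM rmorphB /= swapXY_X swapXY_polyC map_polyC -polyCB.
exists (swapXY S) => //.
by rewrite [in RHS]RE mulrC mul_polyC size_scale // polyXsubC_eq0.
Qed.

Definition xderiv (K : comNzRingType) (P : {poly {poly K}}) : {poly {poly K}} :=
  swapXY ((swapXY P)^`()).

Lemma xderivD (K : comNzRingType) (P Q : {poly {poly K}}) : xderiv (P + Q) = xderiv P + xderiv Q.
Proof. by rewrite /xderiv !rmorphD /= derivD rmorphD. Qed.

Lemma xderivM (K : comNzRingType) (P Q : {poly {poly K}}) :
  xderiv (P * Q) = xderiv P * Q + P * xderiv Q.
Proof. by rewrite /xderiv !rmorphM /= derivM rmorphD !rmorphM /= !swapXYK. Qed.

Lemma xderiv_Xn (K : comNzRingType) n : xderiv ('X^n : {poly {poly K}}) = 0.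
Proof. by rewrite /xderiv rmorphXn /= swapXY_X -polyC_exp derivC rmorph0. Qed.

Lemma xderivC (K : comNzRingType) (c : {poly K}) : xderiv c%:P = (c^`())%:P.
Proof. by rewrite /xderiv swapXY_polyC deriv_map /= -[RHS]swapXYK swapXY_polyC. Qed.

(** The vector field Y^(d-1) d/dX - X^(d-1) d/dY: up to the factor d it is the Hamiltonian field of
    the equation, hence kills it. *)
Lemma fermat_derivation_poly (K : comNzRingType) d :
  exists delta : {poly {poly K}} -> {poly {poly K}},
  [/\ forall P Q, delta (P + Q) = delta P + delta Q,
      forall P Q, delta (P * Q) = delta P * Q + P * delta Q,
      delta (affine_fermat K d) = 0,
      forall c, delta c%:P%:P = 0 & delta 'X%:P = 'X^(d.-1)].
Proof.
exists (fun P => 'X^(d.-1) * xderiv P - ('X^(d.-1))%:P * P^`()); split=> [P Q|P Q||c|].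
- by rewrite xderivD derivD; ring.
- by rewrite xderivM derivM; ring.
- rewrite /affine_fermat xderivD xderiv_Xn xderivC derivD derivC derivXn addr0 add0r.
  rewrite derivD derivXn derivC addr0 -mulr_natl -[in X in _ - X]mulr_natl polyCM polyC_natr; ring.
- by rewrite xderivC !derivC polyC0 !mulr0 subr0.
- by rewrite xderivC derivX derivC mulr1 mulr0 subr0.
Qed.

Section ChartGlobal.
Variables (K : closedFieldType) (charK : [pchar K] =i pred0) (L : fieldType).
Variables (f : {rmorphism K -> L}) (d : nat) (d_gt1 : (1 < d)%N) (x y : L).
Hypothesis ch : fermat_chart f d x y.

Local Notation ev := (ev2 f x y).
Local Notation pt := (ev2 (idfun : {rmorphism K -> K})).
Local Notation oncurve x0 y0 := (x0 ^+ d + y0 ^+ d + 1 = 0).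

Let d_gt0 : (0 < d)%N. Proof. exact: ltnW. Qed.

(* A denominator [c] of least degree is constant: at a root [x0] of [c] the numerator [R]
   would vanish on the whole fibre [x = x0], and [X - x0] could be cancelled. *)
Lemma regular_everywhere w :
  (forall x0 y0, oncurve x0 y0 -> exists k, regular_at f x y x0 y0 w k) ->
  exists2 R : {poly {poly K}}, (size R <= d)%N & w = ev R.
Proof.
move=> hw; have [c [R [c0 sR hR]]] := chart_span ch w.
elim: {c}(size c) {-2}c (leqnn (size c)) R c0 sR hR => [|n IH] c sc R c0 sR hR.
  by move: sc c0; rewrite leqn0 size_poly_eq0 => ->.
have [/size_poly1P [a a0 cE]|/closed_rootP [x0 cx0]] := boolP (size c == 1%N).
  exists (a^-1%:P *: R); first by rewrite (leq_trans (size_scale_leq _ _)).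
  by rewrite -mul_polyC ev2M ev2CC -hR cE map_polyC hornerC mulrCA -rmorphM mulVf // rmorph1 mulr1.
have /factor_theorem [c1 cE] := cx0.
pose r := map_poly (horner_eval x0) R.
suff r0 : r = 0.
  have [R1 RE sR1] := polyC_root_factor r0.
  have c10 : c1 != 0 by apply: contra_neq c0; rewrite cE => ->; rewrite mul0r.
  apply: (IH c1 _ R1) => //; last 2 first.
  - by rewrite sR1.
  - apply: (mulIf (chart_transcendental d_gt0 ch (_ : 'X - x0%:P != 0))); first by rewrite polyXsubC_eq0.
    by rewrite -mulrA -hornerM -rmorphM -cE hR RE ev2M ev2C.
  by rewrite -ltnS (leq_trans _ sc) // cE size_mul ?polyXsubC_eq0 // size_XsubC addn2.
apply/eqP; apply: contraT => r0.
pose F0 := map_poly (horner_eval x0) (affine_fermat K d).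
have F0E z : F0.[z] = z ^+ d + (x0 ^+ d + 1) by rewrite -pt_horner ev2_affine_fermat.
have sF0 : size F0 = d.+1.
  rewrite /F0 rmorphD /= map_polyXn map_polyC /= size_polyDl size_polyXn //.
  by rewrite (leq_ltn_trans (size_polyC_leq1 _)).
have [|z [r1 [E [g [rE FE g0 Ez r1z]]]]] := gcdp_cofactor_root r0 (_ : size r < size F0)%N.
  by rewrite sF0 ltnS (leq_trans (size_poly _ _)).
have onz : oncurve x0 z.
  have := F0E z; rewrite FE hornerM Ez mul0r => ->; ring.
have [k [p [q [q0 hp _]]]] := hw _ _ onz.
(* Reduced modulo X - x0, the relation R q = c p + H F loses its term in c. Cancelling the common
   factor [g] and evaluating at [z] then gives r1(z) q(z) = 0. *)
have /(ev_eq0_dvd d_gt1 ch) [H] : ev (R * q - c%:P * p) = 0.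
  by rewrite ev2B !ev2M -hp -hR ev2C; ring.
move/(congr1 (map_poly (horner_eval x0))); rewrite rmorphB !rmorphM /= map_polyC /=.
rewrite [horner_eval x0 c](rootP cx0) polyC0 mul0r subr0 -/r -/F0 rE FE mulrAC mulrA => /(mulIf g0).
move/(congr1 (horner_eval z)); rewrite /horner_eval !hornerM Ez mulr0 -pt_horner => /eqP.
by rewrite mulf_eq0 (negPf r1z) (negPf q0).
Qed.

(** Since the polynomial derivation kills the equation, it preserves the ideal of the curve and
    descends to the coordinate ring. The quotient rule extends it to [L]; [G] is the graph of this
    extension. *)
Lemma fermat_derivation_exists : exists D : L -> L,
  [/\ forall u v, D (u + v) = D u + D v, forall u v, D (u * v) = D u * v + u * D v,
      forall c, D (f c) = 0 & D x = y ^+ d.-1].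
Proof.
have [delta [deltaD deltaM deltaF deltaC deltaX]] := fermat_derivation_poly K d.
pose G (w w' : L) := exists P Q : {poly {poly K}},
  [/\ ev Q != 0, w * ev Q = ev P & w' * ev Q = ev (delta P) - w * ev (delta Q)].
have Gfun w w1 w2 : G w w1 -> G w w2 -> w1 = w2.
  move=> [P [Q [Q0 e1 e2]]] [P' [Q' [Q0' e1' e2']]].
  have /(ev_eq0_dvd d_gt1 ch) [H hH] : ev (P * Q' - P' * Q) = 0.
    by rewrite ev2B !ev2M -e1 -e1'; ring.
  have : ev (delta (P * Q')) = ev (delta (P' * Q)).
    rewrite -[P * Q'](subrK (P' * Q)) hH deltaD ev2D deltaM deltaF.
    by rewrite mulr0 addr0 ev2M (ev_fermat ch) mulr0 add0r.
  rewrite !deltaM !ev2D !ev2M -e1 -e1' => h.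
  apply: (mulIf Q0); apply: (mulIf Q0').
  rewrite e2 [RHS]mulrAC e2' !mulrBl; apply/eqP; rewrite -subr_eq0; apply/eqP.
  move/eqP: h; rewrite -subr_eq0 => /eqP <-; ring.
have Gtot w : exists w', G w w'.
  have [c [P [c0 _ hP]]] := chart_span ch w.
  have evc0 : ev c%:P != 0 by rewrite ev2C (chart_transcendental d_gt0 ch).
  exists ((ev (delta P) - w * ev (delta c%:P)) / ev c%:P), P, c%:P.
  by split=> //; rewrite ?divfK // ev2C.
pose D w := proj1_sig (constructive_indefinite_description _ (Gtot w)).
have GD w : G w (D w) := proj2_sig (constructive_indefinite_description _ (Gtot w)).
have ev1 : delta (1 : {poly {poly K}}) = 0.
  have := deltaM 1 1; rewrite !mulr1 mul1r => h.
  by apply: (addrI (delta 1)); rewrite addr0 -h.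
have Dev P : D (ev P) = ev (delta P).
  apply: (Gfun _ _ _ (GD _)); exists P, 1.
  by rewrite ev1 ev2_0 ev2_1 oner_neq0 !mulr1 mulr0 subr0.
exists D; split.
- move=> u v; apply: (Gfun _ _ _ (GD _)).
  have [P [Q [Q0 e1 e2]]] := GD u; have [P' [Q' [Q0' e1' e2']]] := GD v.
  exists (P * Q' + P' * Q), (Q * Q'); rewrite deltaD !deltaM; split.
  - by rewrite ev2M mulf_neq0.
  - by rewrite ev2D !ev2M -e1 -e1'; ring.
  transitivity (D u * ev Q * ev Q' + D v * ev Q' * ev Q); first by rewrite ev2M; ring.
  by rewrite e2 e2' !ev2D !ev2M -e1 -e1'; ring.
- move=> u v; apply: (Gfun _ _ _ (GD _)).
  have [P [Q [Q0 e1 e2]]] := GD u; have [P' [Q' [Q0' e1' e2']]] := GD v.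
  exists (P * P'), (Q * Q'); rewrite !deltaM; split.
  - by rewrite ev2M mulf_neq0.
  - by rewrite !ev2M -e1 -e1'; ring.
  transitivity (D u * ev Q * v * ev Q' + u * ev Q * (D v * ev Q')); first by rewrite ev2M; ring.
  by rewrite e2 e2' !ev2D !ev2M -e1 -e1'; ring.
- by move=> c; have := Dev c%:P%:P; rewrite deltaC ev2_0 ev2CC.
- by have := Dev 'X%:P; rewrite deltaX ev2Xn ev2X ev2CX.
Qed.

End ChartGlobal.

(** * Pullback of holomorphic differentials *)

Lemma mmap_scale n (R S : comNzRingType) (f : {rmorphism R -> S}) (v : 'I_n -> S) (h : S)
    m (g : {mpoly R[n]}) :
  g \is m.-homog -> mmap f (fun i => h * v i) g = h ^+ m * mmap f v g.
Proof.
move=> /dhomogP hg; rewrite /mmap mulr_sumr; apply: eq_big_seq => mu /hg <-.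
rewrite mulrCA; congr (_ * _).
rewrite /mmap1 (eq_bigr _ (fun i _ => exprMn _ _ _)) big_split /=; congr (_ * _).
by rewrite mdegE (big_morph _ (exprD h) (expr0 h)).
Qed.

Section HolomorphicForms.
Variables (K : closedFieldType) (charK : [pchar K] =i pred0) (L : fieldType).
Variables (f : {rmorphism K -> L}) (d : nat) (d_gt1 : (1 < d)%N).

Let d_gt0 : (0 < d)%N. Proof. exact: ltnW. Qed.

(** The derivation dual to the differential dx / y^(d-1): D u is the quotient of du by it. *)
Record fermat_derivation (x y : L) (D : L -> L) : Prop := FermatDerivation {
  fderivD : forall u v, D (u + v) = D u + D v;
  fderivM : forall u v, D (u * v) = D u * v + u * D v;
  fderivC : forall c, D (f c) = 0;
  fderivX : D x = y ^+ d.-1 }.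

Section Derivation.
Variables (x y : L) (D : L -> L) (hD : fermat_derivation x y D).

Lemma fderiv0 : D 0 = 0.
Proof. by have := fderivC hD 0; rewrite rmorph0. Qed.

Lemma fderiv1 : D 1 = 0.
Proof. by have := fderivC hD 1; rewrite rmorph1. Qed.

Lemma fderivXn u n : D (u ^+ n.+1) = n.+1%:R * u ^+ n * D u.
Proof.
elim: n => [|n IH]; first by rewrite expr1 expr0 !mul1r.
by rewrite exprS (fderivM hD) IH -[n.+2%:R]/(1 *+ n.+2) mulrS !exprS; ring.
Qed.

Lemma fderivV u : u != 0 -> D u^-1 = - D u / u ^+ 2.
Proof.
move=> u0; have := fderivM hD u u^-1; rewrite divff // fderiv1 => /esym/eqP.
rewrite addrC addr_eq0 => /eqP h; apply: (mulfI u0); rewrite h; by field.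
Qed.

(** Equal to u^2 D(v / u), so a version of the derivative of a ratio that suits homogeneous
    coordinates. *)
Definition wronskian u v := u * D v - v * D u.

(** Both terms containing D h cancel, which makes the expression homogeneous of degree 2 even for a
    variable factor. *)
Lemma wronskian_scale h u v : wronskian (h * u) (h * v) = h ^+ 2 * wronskian u v.
Proof. by rewrite /wronskian !(fderivM hD); ring. Qed.

Lemma wronskian_cyclic a b c : a != 0 -> c != 0 -> a ^+ d + b ^+ d + c ^+ d = 0 ->
  wronskian a b / c ^+ d.-1 = wronskian b c / a ^+ d.-1.
Proof.
move=> a0 c0 habc; have dL : d%:R != 0 :> L.
  by rewrite -(rmorph_nat f) fmorph_eq0 natr_neq0_pchar0.
have hs : a ^+ d.-1 * D a + b ^+ d.-1 * D b + c ^+ d.-1 * D c = 0.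
  apply: (mulfI dL); rewrite mulr0 -(fderiv0) -habc !(fderivD hD).
  by rewrite -[in RHS](prednK d_gt0) !fderivXn (prednK d_gt0); ring.
suff h : a ^+ d.-1 * wronskian a b = c ^+ d.-1 * wronskian b c.
  apply: (mulfI (expf_neq0 d.-1 a0)); rewrite mulrA h [RHS]mulrCA.
  by rewrite divff ?expf_neq0 // mulr1 mulrAC divff ?expf_neq0 // mul1r.
apply/eqP; rewrite -subr_eq0; apply/eqP.
transitivity ((a ^+ d + b ^+ d + c ^+ d) * D b
   - b * (a ^+ d.-1 * D a + b ^+ d.-1 * D b + c ^+ d.-1 * D c)); last first.
  by rewrite habc hs mulr0 mul0r subr0.
by rewrite -[in RHS](prednK d_gt0) !exprS /= /wronskian; ring.
Qed.

End Derivation.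

(** With u = 1/x and w = y/x one has du / w^(d-1) = - x^(d-3) dx / y^(d-1); the dual derivation is
    divided by the same factor. *)
Lemma fermat_derivation_flip m x y D : d = m.+3 -> x != 0 ->
  fermat_derivation x y D ->
  fermat_derivation x^-1 (y / x) (fun u => - D u / x ^+ m).
Proof.
move=> dE x0 hD; split=> [u v|u v|c|].
- by rewrite (fderivD hD); ring.
- by rewrite (fderivM hD); ring.
- by rewrite (fderivC hD) oppr0 mul0r.
- rewrite (fderivV hD) // (fderivX hD) dE /= exprMn exprVn.
  have -> : x ^+ m.+2 = x ^+ m * x ^+ 2 by rewrite -exprD addn2.
  by field; rewrite x0 expf_neq0.
Qed.

Section Local.
Variables (x y : L) (D : L -> L).
Hypotheses (ch : fermat_chart f d x y) (hD : fermat_derivation x y D).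

Local Notation ev := (ev2 f x y).
Local Notation oncurve x0 y0 := (x0 ^+ d + y0 ^+ d + 1 = 0).

Lemma chart_y_neq0 : y != 0.
Proof.
apply/eqP => y0; have eX : ev 'X = 0 by rewrite ev2X.
have sX : (size ('X : {poly {poly K}}) <= d)%N by rewrite size_polyX.
by move/eqP: (chart_free ch sX eX); rewrite polyX_eq0.
Qed.

Lemma fderivY : D y = - x ^+ d.-1.
Proof.
have dL : d%:R != 0 :> L by rewrite -(rmorph_nat f) fmorph_eq0 natr_neq0_pchar0.
have := congr1 D (chart_eq ch).
rewrite !(fderivD hD) (fderiv1 hD) (fderiv0 hD) addr0 -[in LHS](prednK d_gt0) !(fderivXn hD).
rewrite (prednK d_gt0) (fderivX hD) => h.
apply: (mulfI (mulf_neq0 dL (expf_neq0 d.-1 chart_y_neq0))).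
by apply/eqP; rewrite -subr_eq0 -h; apply/eqP; ring.
Qed.

Lemma fderiv_ev P : exists P', D (ev P) = ev P'.
Proof.
elim/poly_ind: P => [|P c [P' hP]]; first by exists 0; rewrite ev2_0 (fderiv0 hD).
have [c' hc] : exists c', D (ev c%:P) = ev c'.
  elim/poly_ind: c => [|c a [c' hc]]; first by exists 0; rewrite polyC0 ev2_0 (fderiv0 hD).
  exists (c' * 'X%:P + c%:P * 'X^(d.-1)).
  rewrite polyCD polyCM !ev2D !ev2M ev2CC ev2CX ev2Xn ev2X (fderivD hD) (fderivM hD).
  by rewrite (fderivC hD) addr0 hc (fderivX hD).
exists (P' * 'X - P * ('X^(d.-1))%:P + c').
rewrite !ev2D ev2N !ev2M ev2X polyC_exp ev2Xn ev2CX (fderivD hD) (fderivM hD) hP hc fderivY.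
by ring.
Qed.

Lemma regular_at_deriv x0 y0 w k :
  regular_at f x y x0 y0 w k -> exists k', regular_at f x y x0 y0 (D w) k'.
Proof.
move=> [p [q [q0 hw _]]]; have [p' hp] := fderiv_ev p; have [q' hq] := fderiv_ev q.
have q20 : ev2 (idfun : {rmorphism K -> K}) x0 y0 (q * q) != 0 by rewrite ev2M mulf_neq0.
exists (ev2 (idfun : {rmorphism K -> K}) x0 y0 (p' * q - p * q') / ev2 (idfun : {rmorphism K -> K}) x0 y0 (q * q)).
exists (p' * q - p * q'), (q * q); split; rewrite ?divfK //.
rewrite ev2B !ev2M -hw -hp -hq -hw (fderivM hD); ring.
Qed.

Lemma regular_at_mmap x0 y0 (v : 'I_3 -> L) (k : 'I_3 -> K) (g : {mpoly K[3]}) :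
  (forall i, regular_at f x y x0 y0 (v i) (k i)) ->
  regular_at f x y x0 y0 (mmap f v g) g.@[k].
Proof.
move=> hv; have reg0 : regular_at f x y x0 y0 0 0.
  by have := regular_at_const f x y x0 y0 0; rewrite rmorph0.
have reg1 : regular_at f x y x0 y0 1 1.
  by have := regular_at_const f x y x0 y0 1; rewrite rmorph1.
rewrite mevalE /mmap /mmap1.
elim/big_rec2: _ => // mu u w _ h; apply: regular_atD h.
apply: regular_atM; first exact: regular_at_const.
elim/big_rec2: _ => // i u' w' _ h; apply: regular_atM h.
exact: regular_atX.
Qed.

End Local.

(** In a valuation ring one of the three coordinates has least order, and division by it makes all
    of them regular. Thus a rational map is defined at every point of a smooth curve. *)
Lemma normalize_at x y (ch : fermat_chart f d x y) (v : 'I_3 -> L) x0 y0 :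
  (forall i, v i != 0) -> x0 ^+ d + y0 ^+ d + 1 = 0 ->
  exists l, forall j, exists k, regular_at f x y x0 y0 (v j / v l) k.
Proof.
move=> v_neq0 on0.
have ratio i j : (exists k, regular_at f x y x0 y0 (v i / v j) k) \/
               (exists k, regular_at f x y x0 y0 (v j / v i) k).
by have := regular_or_inv charK d_gt1 ch on0 (v i / v j); rewrite invf_div.
have reg1 (i : 'I_3) : exists k, regular_at f x y x0 y0 (v i / v i) k.
by exists 1; rewrite divff //; have := regular_at_const f x y x0 y0 1; rewrite rmorph1.
have trans i j l : (exists k, regular_at f x y x0 y0 (v i / v j) k) ->
  (exists k, regular_at f x y x0 y0 (v j / v l) k) ->
  (exists k, regular_at f x y x0 y0 (v i / v l) k).
move=> [k hk] [k' hk']; exists (k * k'); have := regular_atM hk hk'.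
by rewrite mulrA divfK.
have all3 l : (exists k, regular_at f x y x0 y0 (v 0 / v l) k) ->
   (exists k, regular_at f x y x0 y0 (v 1 / v l) k) ->
   (exists k, regular_at f x y x0 y0 (v 2 / v l) k) ->
   forall j, exists k, regular_at f x y x0 y0 (v j / v l) k.
  move=> a b c [[|[|[|//]]] hj].
  + by have -> : Ordinal hj = 0 by apply: val_inj.
  + by have -> : Ordinal hj = 1 by apply: val_inj.
  + by have -> : Ordinal hj = 2 by apply: val_inj.
case: (ratio 0 1) => h01.
  case: (ratio 1 2) => h12; first by exists 2; apply: all3 => //; apply: trans h12.
  by exists 1; apply: all3.
case: (ratio 0 2) => h02; first by exists 2; apply: all3 => //; apply: trans h02.
by exists 0; apply: all3.
Qed.

(* The function [J] for which [J dx / y ^ (d - 1)] is the pullback, along the map to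
   the Fermat curve with coordinates [v] (scaled so that [v 2 = 1]), of the differential [dX / Y ^ (d - 1)]. *)
Definition pullback_factor (D : L -> L) (v : 'I_3 -> L) : L :=
  wronskian D (v 0) (v 1) / v 2 ^+ d.-1.

Section Pullback.
Variables (m : nat) (dE : d = m.+3) (v : 'I_3 -> L).
Hypotheses (v_neq0 : forall i, v i != 0) (v_fermat : v 0 ^+ d + v 1 ^+ d + v 2 ^+ d = 0).
Variables (g : {mpoly K[3]}) (g_homog : g \is m.-homog).

(** Let h be the coordinate of least order at the point; by the cyclic symmetry of the factor it may
    stand in the denominator. After scaling by h, the form contributes h^m and the Wronskian h^2,
    which cancel h^(d-1) exactly because m = d - 3. *)
Lemma pullback_regular_at x y D (ch : fermat_chart f d x y) (hD : fermat_derivation x y D)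
  x0 y0 : x0 ^+ d + y0 ^+ d + 1 = 0 ->
  exists k, regular_at f x y x0 y0 (mmap f v g * pullback_factor D v) k.
Proof.
move=> on0.
have [h [h0 hh]] : exists h, h != 0 /\
    (forall j, exists k, regular_at f x y x0 y0 (v j / h) k) /\
    exists i j, exists2 l, v l = h &
       pullback_factor D v = wronskian D (v i) (v j) / v l ^+ d.-1.
  have [l hl] := normalize_at ch v_neq0 on0.
  exists (v l); split=> //; split=> //.
  have c1 := wronskian_cyclic hD (v_neq0 0) (v_neq0 2) v_fermat.
  have v_fermat' : v 1 ^+ d + v 2 ^+ d + v 0 ^+ d = 0 by rewrite -v_fermat; ring.
  have c2 := wronskian_cyclic hD (v_neq0 1) (v_neq0 0) v_fermat'.
  case: l {hl} => [[|[|[|//]]] hl].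
  - exists 1, 2, 0; first by congr v; apply: val_inj.
    by rewrite /pullback_factor c1.
  - exists 2, 0, 1; first by congr v; apply: val_inj.
    by rewrite /pullback_factor c1 c2.
  - by exists 0, 1, 2; first by congr v; apply: val_inj.
have [hreg [i [j [l vl ->]]]] := hh; rewrite vl.
have [k hk] : exists k : 'I_3 -> K, forall j, regular_at f x y x0 y0 (v j / h) (k j).
  exists (fun j => proj1_sig (constructive_indefinite_description _ (hreg j))) => j'.
  exact: (proj2_sig (constructive_indefinite_description _ (hreg j'))).
have vE j' : v j' = h * (v j' / h) by rewrite mulrC divfK.
have -> : mmap f v g = h ^+ m * mmap f (fun i => v i / h) g.
  rewrite -(mmap_scale _ _ _ g_homog); apply: eq_bigr => mu _; congr (_ * _).
  by apply: eq_bigr => j' _; rewrite -vE.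
rewrite (vE i) (vE j) (wronskian_scale hD).
have -> : d.-1 = (m + 2)%N by rewrite dE addn2.
rewrite exprD.
have -> : h ^+ m * mmap f (fun i : 'I_3 => v i / h) g *
   (h ^+ 2 * wronskian D (v i / h) (v j / h) / (h ^+ m * h ^+ 2))
   = mmap f (fun i : 'I_3 => v i / h) g * wronskian D (v i / h) (v j / h).
  by field; rewrite h0 expf_neq0.
have [k1 hk1] := regular_at_deriv ch hD (hk i); have [k2 hk2] := regular_at_deriv ch hD (hk j).
exists (g.@[k] * (k i * k2 - k j * k1)); apply: regular_atM; first exact: regular_at_mmap.
rewrite /wronskian -mulN1r -[- (k j * k1)]mulN1r; apply: regular_atD; first exact: regular_atM.
apply: regular_atM; last exact: regular_atM.
by have := regular_at_const f x y x0 y0 (-1); rewrite rmorphN rmorph1.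
Qed.

(* Regularity in the chart [(x, y)] gives a polynomial; regularity in the chart [(1/x, y/x)],
   where the factor becomes [- x ^- m] times the former one, bounds its degree by [m]. *)
Lemma pullback_holomorphic x y D (ch : fermat_chart f d x y) (hD : fermat_derivation x y D) :
  exists2 R : {poly {poly K}}, mmap f v g * pullback_factor D v = ev2 f x y R &
    forall i, R`_i != 0 -> (size (R`_i)%R + i <= m.+1)%N.
Proof.
have [R sR hR] := regular_everywhere d_gt1 ch (fun x0 y0 => @pullback_regular_at x y D ch hD x0 y0).
have x0 : x != 0.
  by have := chart_transcendental d_gt0 ch (negbT (polyX_eq0 K)); rewrite map_polyX hornerX.
have ch' := chart_flip d_gt0 ch; have hD' := fermat_derivation_flip dE x0 hD.
have [R' sR' hR'] := regular_everywhere d_gt1 ch' (fun x0 y0 => pullback_regular_at ch' hD' (x0:=x0) (y0:=y0)).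
have [N0 /(_ _ (leq_addr d N0)) [P [sP hP _ szP]]] := ev2_flip f y x0 sR'.
exists R => // i Ri0.
have hi : (i < d)%N by apply: contraNT Ri0; rewrite -leqNgt => hi; rewrite nth_default // (leq_trans sR).
(* The same pullback read in the two charts; the factor - x^(-m) comes from the flipped derivation.
   Comparing degrees coefficient by coefficient turns the bound on [P] into the bound on [R]. *)
have e : ev2 f x y ('X%:P ^+ (N0 + d) * R + 'X%:P ^+ m * P) = 0.
  rewrite ev2D !ev2M !ev2Xn ev2CX hP -hR -hR' /pullback_factor /wronskian.
  by field; rewrite expf_neq0 ?expf_neq0.
have := chart_free ch _ e.
rewrite -!polyC_exp !mul_polyC => h.
have /(congr1 (fun Q : {poly {poly K}} => Q`_i)) : 'X^(N0 + d) *: R + 'X^m *: P = 0.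
  apply: h; rewrite (leq_trans (size_polyD _ _)) // geq_max.
  by rewrite !(leq_trans (size_scale_leq _ _)).
rewrite coefD !coefZ coef0 => /eqP; rewrite addr_eq0 => /eqP/(congr1 (fun p : {poly K} => size p)).
rewrite size_polyN ![_ * _`_i]mulrC size_mulXn // => hs.
have Pi0 : P`_i != 0.
  by apply: contraNneq Ri0 => P0; rewrite -size_poly_eq0 -leqn0 -(leq_add2l (N0 + d)) hs P0 mul0r size_poly0.
move: hs; rewrite size_mulXn // => hs.
rewrite -(leq_add2l (N0 + d)) addnA hs -addnA addnS -addSn [(_.+1 + m)%N]addnC leq_add2l.
exact: szP.
Qed.

End Pullback.

End HolomorphicForms.

(** * Ternary forms at the generic point *)

Definition vec3 (T : Type) (a b c : T) : 'I_3 -> T := fun i => nth a [:: a; b; c] i.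

Definition dehomog (K : comNzRingType) (t : 'I_3 -> {poly {poly K}}) (p : {mpoly K[3]}) :
  {poly {poly K}} := mmap (@polyC {poly K} \o @polyC K) t p.

Lemma ev2_dehomog (K S : comNzRingType) (f : {rmorphism K -> S}) (x y : S)
    (t : 'I_3 -> {poly {poly K}}) p :
  ev2 f x y (dehomog t p) = mmap f (ev2 f x y \o t) p.
Proof.
rewrite /dehomog /mmap ev2_sum; apply: eq_bigr => mu _; rewrite ev2M ev2CC; congr (_ * _).
rewrite /mmap1 (big_morph _ (ev2M f x y) (ev2_1 f x y)); apply: eq_bigr => i _.
by rewrite ev2Xn.
Qed.

Lemma eq_mmap n (R S : nzRingType) (f : R -> S) (v w : 'I_n -> S) p :
  v =1 w -> mmap f v p = mmap f w p.
Proof. by move=> vw; apply: eq_bigr => mu _; congr (_ * _); apply: eq_bigr => i _; rewrite vw. Qed.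

Lemma ord3P (P : 'I_3 -> Prop) : P 0 -> P 1 -> P 2 -> forall i, P i.
Proof.
move=> h0 h1 h2 [[|[|[|//]]] hi].
- by have -> : Ordinal hi = 0 by apply: val_inj.
- by have -> : Ordinal hi = 1 by apply: val_inj.
- by have -> : Ordinal hi = 2 by apply: val_inj.
Qed.

Definition affine_coords (K : comNzRingType) : 'I_3 -> {poly {poly K}} := vec3 'X%:P 'X 1.

Lemma ev2_affine_coords (K S : comNzRingType) (f : {rmorphism K -> S}) (x y : S) p :
  ev2 f x y (dehomog (affine_coords K) p) = mmap f (vec3 x y 1) p.
Proof.
rewrite ev2_dehomog; apply: eq_mmap; apply: ord3P => /=.
- by rewrite ev2CX.
- by rewrite ev2X.
- by rewrite ev2_1.
Qed.

Lemma sum3 (V : nmodType) (F : 'I_3 -> V) : \sum_(i < 3) F i = F 0 + F 1 + F 2.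
Proof.
rewrite !big_ord_recr big_ord0 /= add0r; congr (F _ + F _ + F _); exact: val_inj.
Qed.

Lemma prod3 (R : comNzRingType) (F : 'I_3 -> R) : \prod_(i < 3) F i = F 0 * F 1 * F 2.
Proof.
rewrite !big_ord_recr big_ord0 /= mul1r; congr (F _ * F _ * F _); exact: val_inj.
Qed.

Lemma sum3n (F : 'I_3 -> nat) : (\sum_(i < 3) F i)%N = (F 0%R + F 1%R + F 2%R)%N.
Proof.
rewrite !big_ord_recr big_ord0 /= add0n; congr (F _ + F _ + F _)%N; exact: val_inj.
Qed.

(** In a fixed degree the exponents of X and Y determine that of Z, so nothing is lost by setting Z
    = 1. *)
Lemma coef_dehomog (K : comNzRingType) m (p : {mpoly K[3]}) (mu : 'X_{1..3}) :
  p \is m.-homog -> mdeg mu = m -> (dehomog (affine_coords K) p)`_(mu 1)`_(mu 0) = p@_mu.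
Proof.
move=> /dhomogP hp hmu; rewrite /dehomog /mmap coef_sum coef_sum.
rewrite (eq_big_seq (fun nu => if nu == mu then p@_mu else 0)); last first.
  move=> nu /hp hnu; rewrite /mmap1 prod3 /affine_coords /vec3 /= expr1n mulr1.
  rewrite mulrA -polyC_exp -polyCM coefCM coefXn mulr_natr.
  have [->|ne] := eqVneq nu mu; first by rewrite eqxx mulr1n coefCM coefXn eqxx mulr1.
  have [e1|] := eqVneq (mu 1) (nu 1); last by rewrite mulr0n coef0.
  rewrite mulr1n coefCM coefXn; have [e0|] := eqVneq (mu 0) (nu 0); last by rewrite mulr0.
  case/eqP: ne; apply/mnmP; apply: ord3P => //.
  by move: hnu; rewrite -[LHS]/(mdeg nu) -hmu !mdegE !sum3n e0 e1 => /addnI.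
have [mp|mp] := boolP (mu \in msupp p).
  rewrite (bigD1_seq mu) //= eqxx big1 ?addr0 // => nu /negPf -> //.
rewrite big_seq big1 ?memN_msupp_eq0 // => nu nup.
by case: eqP => // e; rewrite -e nup in mp.
Qed.

Lemma size_dehomog (K : comNzRingType) m (p : {mpoly K[3]}) :
  p \is m.-homog -> (size (dehomog (affine_coords K) p) <= m.+1)%N.
Proof.
move=> /dhomogP hp; apply/leq_sizeP => j hj; rewrite /dehomog /mmap coef_sum.
rewrite big_seq big1 // => mu /hp hmu; rewrite /mmap1 prod3 /affine_coords /vec3 /= expr1n mulr1.
rewrite mulrA -polyC_exp -polyCM coefCM coefXn.
suff /ltn_eqF : (mu 1%R < j)%N by rewrite eq_sym => ->; rewrite mulr0.
by rewrite (leq_trans _ hj) // ltnS -hmu -[X in (_ <= X)%N]/(mdeg mu) mdegE sum3n addnAC leq_addl.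
Qed.

Lemma dehomog_eq0 (K : comNzRingType) m (p : {mpoly K[3]}) :
  p \is m.-homog -> dehomog (affine_coords K) p = 0 -> p = 0.
Proof.
move=> hp h; apply/mpolyP => mu; rewrite mcoeff0.
have [hmu|hmu] := eqVneq (mdeg mu) m; first by rewrite -(coef_dehomog hp hmu) h !coef0.
exact: dhomog_nemf_coeff hp hmu.
Qed.

Lemma dvd_X0 (K : comNzRingType) m (p : {mpoly K[3]}) :
  p \is m.+1.-homog -> map_poly (horner_eval 0) (dehomog (affine_coords K) p) = 0 ->
  exists2 q, q \is m.-homog & p = 'X_0 * q.
Proof.
move=> hp h0; have hmu mu : mu \in msupp p -> (U_(0%R) <= mu)%MM.
  move=> mup; apply/mnm_lepP => i; rewrite mnm1E; case: eqP => // <-.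
  rewrite lt0n; apply: contraL mup => /eqP mu0.
  rewrite -mcoeff_eq0; have [hd|hd] := eqVneq (mdeg mu) m.+1; last first.
    by rewrite (dhomog_nemf_coeff hp hd).
  rewrite -(coef_dehomog hp hd) mu0.
  move/(congr1 (fun q : {poly K} => q`_(mu 1%R))): h0.
  by rewrite coef0 coef_map_id0 /horner_eval ?horner0 // horner_coef0 => ->.
exists (\sum_(mu <- msupp p) p@_mu *: 'X_[mu - U_(0%R)]).
  rewrite big_seq; apply: rpred_sum => mu mup; apply: rpredZ; rewrite dhomogX /=.
  rewrite -eqSS -(dhomogP _ _ _ hp mu mup) /= -[X in _ == X]/(mdeg mu).
  by rewrite -{2}(submK (hmu _ mup)) mdegD mdeg1 addn1.
rewrite {1}[p]mpolyE mulr_sumr; apply: eq_big_seq => mu /hmu mu0.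
by rewrite -scalerAr -mpolyXD addmC submK.
Qed.

Section GenericPoint.
Variables (K : closedFieldType) (charK : [pchar K] =i pred0) (L : fieldType).
Variables (f : {rmorphism K -> L}) (d : nat) (d_gt1 : (1 < d)%N) (x y : L).
Hypothesis ch : fermat_chart f d x y.

Let d_gt0 : (0 < d)%N. Proof. exact: ltnW. Qed.

Definition generic_point : 'I_3 -> L := vec3 x y 1.
Local Notation xi := generic_point.

Lemma mmap_generic_eq0 m (p : {mpoly K[3]}) :
  p \is m.-homog -> (m < d)%N -> mmap f xi p = 0 -> p = 0.
Proof.
move=> hp md; rewrite -ev2_affine_coords => h; apply: (dehomog_eq0 hp).
by apply: (chart_free ch) h; apply: leq_trans (size_dehomog hp) md.
Qed.

Lemma form_of_affine m (R : {poly {poly K}}) :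
  (forall i, R`_i != 0 -> (size (R`_i)%R + i <= m.+1)%N) ->
  exists2 p, p \is m.-homog & ev2 f x y R = mmap f xi p.
Proof.
move=> hR; have sR : (size R <= m.+1)%N.
  apply/leq_sizeP => j hj; apply/eqP; apply: contraT => Rj.
  have := hR j Rj; rewrite leqNgt => /negP; case.
  by rewrite -add1n leq_add // size_poly_gt0.
exists (\sum_(i < m.+1) \sum_(j < m.+1 - i) (R`_i)`_j *: ('X_0 ^+ j * 'X_1 ^+ i * 'X_2 ^+ (m - i - j))).
  apply: rpred_sum => i _; apply: rpred_sum => j _; apply: rpredZ.
  have hX (l : 'I_3) k : ('X_l ^+ k : {mpoly K[3]}) \is k.-homog.
    by rewrite -{2}[k]mul1n; apply: dhomogMn; rewrite dhomogX /= mdeg1.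
  have im : (i <= m)%N by rewrite -ltnS.
  have ji : (j <= m - i)%N by have := ltn_ord j; rewrite {2}subSn.
  have mE : (j + i + (m - i - j))%N = m by rewrite addnAC subnKC // subnK.
  by have := dhomogM (dhomogM (hX 0 j) (hX 1 i)) (hX 2 (m - i - j)%N); rewrite mE.
rewrite (ev2E _ _ _ sR) raddf_sum; apply: eq_bigr => i _ /=.
have sRi : (size (R`_i)%R <= m.+1 - i)%N.
  have [->|Ri] := eqVneq (R`_i) 0; first by rewrite size_poly0.
  by rewrite leq_subRL ?(ltnW (ltn_ord i)) // addnC hR.
rewrite (horner_coef_wide _ (leq_trans (size_poly _ _) sRi)) raddf_sum mulr_suml /=.
apply: eq_bigr => j _; rewrite mmapZ !rmorphM !rmorphXn /= !mmapX !mmap1U coef_map /=.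
by rewrite /generic_point /vec3 /= expr1n mulr1 mulrA.
Qed.

End GenericPoint.

(** * From forms of degree d - 3 to linear forms *)

Section Descent.
Variables (K : closedFieldType) (charK : [pchar K] =i pred0) (L : fieldType).
Variables (f : {rmorphism K -> L}) (d : nat) (d_gt1 : (1 < d)%N) (x y : L).
Hypothesis ch : fermat_chart f d x y.
Local Notation xi := (generic_point x y).

Let d_gt0 : (0 < d)%N. Proof. exact: ltnW. Qed.

Variable v : 'I_3 -> L.
Hypothesis v_neq0 : forall i, v i != 0.
(** The point [v] lies on no curve of degree less than [d]; for a birational self-map this comes
    from its inverse. *)
Hypothesis v_inj : forall m (g : {mpoly K[3]}),
  (m < d)%N -> g \is m.-homog -> mmap f v g = 0 -> g = 0.

(** For nonzero [J], this plays the part of an isomorphism from the pullback of O(m) to O(m), seen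
    on global sections. *)
Definition pulls_back m (J : L) := forall g : {mpoly K[3]}, g \is m.-homog ->
  exists2 h : {mpoly K[3]}, h \is m.-homog & mmap f v g * J = mmap f xi h.

(** A linear relation between the images of a basis would give a form of degree m vanishing at [v].
    So these images are free, and there are as many of them as the dimension of the space of
    forms. *)
Lemma pulls_back_onto m (J : L) (h : {mpoly K[3]}) : (m < d)%N -> J != 0 ->
  pulls_back m J -> h \is m.-homog ->
  exists2 g : {mpoly K[3]}, g \is m.-homog & mmap f v g * J = mmap f xi h.
Proof.
move=> md J0 hJ hh; pose V : vectType K := dhomog 3 K m.
have [phi hphi] : exists phi : V -> V, forall g : V,
    mmap f v (val g) * J = mmap f xi (val (phi g)).
  have tot (g : V) : exists h : V, mmap f v (val g) * J = mmap f xi (val h).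
    have [h' h1 h2] := hJ (val g) (dhomog_is_dhomog g).
    by exists (DHomog h1).
  exists (fun g => proj1_sig (constructive_indefinite_description _ (tot g))) => g.
  exact: (proj2_sig (constructive_indefinite_description _ (tot g))).
pose b := vbasis (fullv : {vspace V}).
have bb : basis_of fullv b := vbasisP _.
pose c := map_tuple phi b.
have val_lin n' (k : 'I_n' -> K) (F : 'I_n' -> V) w :
    mmap f w (val (\sum_(i < n') k i *: F i)) = \sum_(i < n') f (k i) * mmap f w (val (F i)).
  rewrite raddf_sum raddf_sum; apply: eq_bigr => i _; exact: mmapZ.
have cfree : free c.
  apply/freeP => k hk i.
  have /freeP := basis_free bb; apply=> {i}; apply: val_inj => /=.
  apply: (v_inj md (dhomog_is_dhomog _)); apply: (mulIf J0); rewrite mul0r val_lin mulr_suml.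
  have := congr1 (fun w : V => mmap f xi (val w)) hk; rewrite val_lin /= mmap0 => e; rewrite -[RHS]e.
  apply: eq_bigr => i _; rewrite -mulrA hphi /c.
  by rewrite (nth_map 0) // size_tuple.
have cb : basis_of fullv c.
  by rewrite basisEfree cfree subvf size_tuple leqnn.
have hmem : DHomog hh \in <<c>>%VS by rewrite (span_basis cb) memvf.
have e := coord_span hmem.
exists (val (\sum_(i < \dim (fullv : {vspace V})) coord c i (DHomog hh) *: b`_i)); first exact: dhomog_is_dhomog.
transitivity (mmap f xi (val (DHomog hh))); last by [].
rewrite [in RHS]e; rewrite !val_lin mulr_suml; apply: eq_bigr => i _.
by rewrite -mulrA hphi /c (nth_map 0) // size_tuple.
Qed.

Local Notation X k := ('X_k : {mpoly K[3]}).

Lemma homogXn (k : 'I_3) n : X k ^+ n \is n.-homog.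
Proof. by rewrite -{2}[n]mul1n; apply: dhomogMn; rewrite dhomogX /= mdeg1. Qed.

Lemma homogX (k : 'I_3) : X k \is 1.-homog.
Proof. by rewrite dhomogX /= mdeg1. Qed.

(* [k] is the image of the point [(0 : b : 1)] under the map with coordinates [v]. *)
Definition image_of m (J : L) (b : K) (k : 'I_3 -> K) (j : K) :=
  [/\ exists l, k l != 0, j != 0 &
      forall g h : {mpoly K[3]}, g \is m.-homog -> h \is m.-homog ->
        mmap f v g * J = mmap f xi h -> h.@[vec3 0 b 1] = j * g.@[k]].

(** The vector [k] consists of the values at (0, b) of the coordinates divided by the one of least
    order, v_l, and [j] is the value of J v_l^m, itself a form at the generic point. It is nonzero
    because some form pulls back to Z^m, which is 1 at (0 : b : 1). *)
Lemma image_exists m J b : (m < d)%N -> J != 0 -> pulls_back m J -> b ^+ d = -1 ->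
  exists k j, image_of m J b k j.
Proof.
move=> md J0 hJ hb.
have on0 : 0 ^+ d + b ^+ d + 1 = 0 :> K by rewrite expr0n gtn_eqF // hb add0r addNr.
have [l hl] := normalize_at charK d_gt1 ch v_neq0 on0.
have [k hk] : exists k : 'I_3 -> K, forall j, regular_at f x y 0 b (v j / v l) (k j).
  exists (fun j => proj1_sig (constructive_indefinite_description _ (hl j))) => j'.
  exact: (proj2_sig (constructive_indefinite_description _ (hl j'))).
have regxi h : regular_at f x y 0 b (mmap f xi h) h.@[vec3 0 b 1].
  have := regular_at_ev f x y 0 b (dehomog (affine_coords K) h).
  by rewrite !ev2_affine_coords.
have kl : k l = 1.
  apply: (regular_at_uniq d_gt1 ch on0 (hk l)); rewrite divff //.
  by have := regular_at_const f x y 0 b 1; rewrite rmorph1.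
have [h0 h0m h0E] := hJ _ (homogXn l m).
pose u := J * v l ^+ m.
have uE g : g \is m.-homog -> mmap f v g * J = mmap f (fun i => v i / v l) g * u.
  move=> hg; rewrite /u (mulrC J) mulrA [_ * v l ^+ m]mulrC -(mmap_scale f (fun i => v i / v l) (v l) hg).
  by congr (_ * _); apply: eq_mmap => i; rewrite mulrC divfK.
have hu : u = mmap f xi h0.
  rewrite -h0E uE ?homogXn // rmorphXn /= mmapX mmap1U divff // expr1n mul1r //.
exists k, h0.@[vec3 0 b 1].
have key g h : g \is m.-homog -> h \is m.-homog ->
    mmap f v g * J = mmap f xi h -> h.@[vec3 0 b 1] = h0.@[vec3 0 b 1] * g.@[k].
  move=> gm hm e; apply: (regular_at_uniq d_gt1 ch on0 (regxi h)).
  rewrite -e uE // hu mulrC; apply: regular_atM; first exact: regxi.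
  exact: regular_at_mmap.
split=> //; first by exists l; rewrite kl oner_neq0.
have [g gm gE] := pulls_back_onto md J0 hJ (homogXn 2 m).
have := key _ _ gm (homogXn 2 m) gE; rewrite rmorphXn /= mevalXU /vec3 /= expr1n => e.
by apply: contra_neq (oner_neq0 K) => h; rewrite e h mul0r.
Qed.

Lemma meval_scale m (g : {mpoly K[3]}) c (k : 'I_3 -> K) :
  g \is m.-homog -> g.@[fun i => c * k i] = c ^+ m * g.@[k].
Proof. exact: (@mmap_scale _ _ _ (idfun : {rmorphism K -> K})). Qed.

(** The forms Z^(m+1) and Y Z^m are both pullbacks, and their ratio at (0 : b : 1) is b. If the two
    image points coincided, the ratios b and b' would agree. *)
Lemma image_separated m J b b' k j k' j' : (m.+1 < d)%N -> J != 0 -> pulls_back m.+1 J ->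
  image_of m.+1 J b k j -> image_of m.+1 J b' k' j' -> b != b' ->
  exists i1 i2, k i1 * k' i2 - k i2 * k' i1 != 0.
Proof.
move=> md J0 hJ [[l kl] j0 hk] [[l' kl'] j0' hk'] bb'; apply: NNPP => hno.
have par i1 i2 : k i1 * k' i2 = k i2 * k' i1.
  apply/eqP; rewrite -subr_eq0; apply: contraT => h; case: hno; by exists i1, i2.
pose c := k' l / k l.
have kE i : k' i = c * k i by rewrite /c mulrAC [k' l * _]mulrC -par mulrAC divff // mul1r.
have [g gm gE] := pulls_back_onto md J0 hJ (homogXn 2 m.+1).
have hm2 : X 1 * X 2 ^+ m \is m.+1.-homog.
  exact: (dhomogM (homogX 1) (homogXn 2 m)).
have [g' gm' gE'] := pulls_back_onto md J0 hJ hm2.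
have ck : g.@[k'] = c ^+ m.+1 * g.@[k] by rewrite -(meval_scale _ _ gm); apply: meval_eq.
have ck' : g'.@[k'] = c ^+ m.+1 * g'.@[k] by rewrite -(meval_scale _ _ gm'); apply: meval_eq.
have e1 := hk _ _ gm (homogXn 2 _) gE; have e2 := hk' _ _ gm (homogXn 2 _) gE.
have e3 := hk _ _ gm' hm2 gE'; have e4 := hk' _ _ gm' hm2 gE'.
move: e1 e2 e3 e4; rewrite !rmorphM !rmorphXn /= !mevalXU /vec3 /= !expr1n !mulr1 ck ck'.
move=> e1 e2 e3 e4; case/eqP: bb'; rewrite e3 e4 mulrA; congr (_ * _).
have gk : g.@[k] != 0 by apply: contra_neq (oner_neq0 K) => h; rewrite e1 h mulr0.
by apply: (mulIf gk); rewrite -e1 -mulrA -e2.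
Qed.

(** The equation of the line through two points of the plane, as a cross product. *)
Definition cross (k k' : 'I_3 -> K) : {mpoly K[3]} :=
  (k 1 * k' 2 - k 2 * k' 1) *: X 0 + (k 2 * k' 0 - k 0 * k' 2) *: X 1
  + (k 0 * k' 1 - k 1 * k' 0) *: X 2.

Lemma cross_homog k k' : cross k k' \is 1.-homog.
Proof. by rewrite !rpredD // rpredZ // homogX. Qed.

Lemma cross_meval k k' w : (cross k k').@[w] =
  (k 1 * k' 2 - k 2 * k' 1) * w 0 + (k 2 * k' 0 - k 0 * k' 2) * w 1
  + (k 0 * k' 1 - k 1 * k' 0) * w 2.
Proof. by rewrite !mevalD !mevalZ !mevalXU. Qed.

Lemma cross_neq0 k k' i1 i2 : k i1 * k' i2 - k i2 * k' i1 != 0 -> cross k k' != 0.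
Proof.
move=> h; apply/eqP => e0; have ev w : (cross k k').@[w] = 0 by rewrite e0 meval0.
have {ev} := (ev (vec3 1 0 0), ev (vec3 0 1 0), ev (vec3 0 0 1)).
rewrite !cross_meval /vec3 /= !(mulr0, mulr1, addr0, add0r) => -[[h0 h1] h2].
case/eqP: h; move: h0 h1 h2 => /eqP; rewrite subr_eq0 => /eqP h0 /eqP; rewrite subr_eq0 => /eqP h1.
move=> /eqP; rewrite subr_eq0 => /eqP h2.
by move: i1 i2; do 2!apply: ord3P; rewrite ?h0 ?h1 ?h2 ?subrr.
Qed.

Lemma vanish_on_line m (h : {mpoly K[3]}) (s : seq K) : h \is m.-homog ->
  uniq s -> (m < size s)%N -> (forall b, b \in s -> h.@[vec3 0 b 1] = 0) ->
  map_poly (horner_eval 0) (dehomog (affine_coords K) h) = 0.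
Proof.
move=> hm us ss hs; apply: (@roots_geq_poly_eq0 _ _ s) => //; last first.
  by rewrite (leq_trans _ ss) // (leq_trans (size_poly _ _)) // size_dehomog.
by apply/allP => b /hs hb; rewrite rootE -pt_horner ev2_affine_coords -[_ _ h]/(h.@[_]) hb.
Qed.

(* The images of the [d] points of the line [X = 0] are collinear: otherwise a product of
   [m + 1] lines vanishes at all but one of [m + 3] of them, while its pullback, of degree
   [m + 1], has [m + 2] zeros on [X = 0] and so vanishes at the remaining point. Hence the
   pullback of the equation of the line through the images is divisible by [X]. *)
Lemma pulls_back_descent m J : (m.+4 <= d)%N -> J != 0 -> pulls_back m.+1 J ->
  exists2 J', J' != 0 & pulls_back m J'.
Proof.
move=> md J0 hJ; have md' : (m.+1 < d)%N by rewrite (leq_trans _ md) // ltnW.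
have [|s [ss us ms]] := XnsubC_roots charK d_gt0 (a := -1); first by rewrite oppr_eq0 oner_neq0.
have sm b : b \in s -> b ^+ d = -1 by rewrite ms => /eqP.
have [kk hkk] : exists kk : K -> 'I_3 -> K, forall b, b \in s -> exists j, image_of m.+1 J b (kk b) j.
  have tot b : exists k, b \in s -> exists j, image_of m.+1 J b k j.
    have [/sm hb|_] := boolP (b \in s); last by exists (fun=> 0).
    by have [k hk] := image_exists md' J0 hJ hb; exists k.
  exists (fun b => proj1_sig (constructive_indefinite_description _ (tot b))) => b.
  exact: (proj2_sig (constructive_indefinite_description _ (tot b))).
have hgv g h b : g \is m.+1.-homog -> h \is m.+1.-homog -> mmap f v g * J = mmap f xi h ->
    b \in s -> (h.@[vec3 0 b 1] == 0) = (g.@[kk b] == 0).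
  move=> gm hm e /hkk [j [_ j0 hj]].
  by rewrite (hj _ _ gm hm e) mulf_eq0 (negPf j0).
have sep b b' : b \in s -> b' \in s -> b != b' ->
    exists i1 i2, kk b i1 * kk b' i2 - kk b i2 * kk b' i1 != 0.
  by move=> /hkk [j hj] /hkk [j' hj']; apply: image_separated md' J0 hJ hj hj'.
case: s ss us ms sm hkk hgv sep => [|b1 [|b2 s]] ss us ms sm hkk hgv sep.
- by move: md; rewrite -ss.
- by move: md; rewrite -ss.
have hb1 : b1 \in [:: b1, b2 & s] by rewrite mem_head.
have hb2 : b2 \in [:: b1, b2 & s] by rewrite !inE eqxx orbT.
have [i1 [i2 h12]] : exists i1 i2, kk b1 i1 * kk b2 i2 - kk b1 i2 * kk b2 i1 != 0.
  by apply: sep => //; move: us; rewrite /= inE negb_or; case/andP=> /andP[].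
pose alpha := cross (kk b1) (kk b2).
have alpha0 : alpha != 0 := cross_neq0 h12.
have alphaE : forall b, b \in [:: b1, b2 & s] -> alpha.@[kk b] = 0.
  move=> b; rewrite !inE => /or3P[/eqP ->|/eqP ->|bs]; try by rewrite cross_meval; ring.
  apply/eqP; apply: contraT => alphab.
  have bs' : b \in [:: b1, b2 & s] by rewrite !inE bs !orbT.
  have [us1 us2] : uniq s /\ {subset s <= [:: b1, b2 & s]}.
    by split=> [|c cs]; [move: us => /= /and3P[] | rewrite !inE cs !orbT].
  have prod (r : seq K) : {subset r <= s} -> b \notin r -> exists p : {mpoly K[3]},
      [/\ p \is (size r).-homog, p.@[kk b] != 0 & forall c, c \in r -> p.@[kk c] = 0].
    elim: r => [|c r IH] rs br.
      by exists 1; rewrite dhomog1 meval1 oner_neq0.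
    have [||p [pm pb pr]] := IH; first by move=> z zr; apply: rs; rewrite inE zr orbT.
      by move: br; rewrite inE negb_or => /andP[].
    have cs : c \in [:: b1, b2 & s] by rewrite us2 // rs // mem_head.
    (* A nonzero 2x2 minor of the images of [c] and [b] gives a linear form that vanishes at the
       first and not at the second. *)
    have [|j1 [j2 hj]] := sep c b cs bs'.
      by move: br; rewrite inE negb_or eq_sym => /andP[].
    exists ((kk c j1 *: X j2 - kk c j2 *: X j1) * p); split.
    - have l1 : kk c j1 *: X j2 - kk c j2 *: X j1 \is 1.-homog by rewrite rpredB // rpredZ // homogX.
      exact: (dhomogM l1 pm).
    - by rewrite mevalM mulf_neq0 // mevalB !mevalZ !mevalXU.
    move=> c'; rewrite inE => /orP[/eqP ->|c'r]; rewrite mevalM; last by rewrite pr ?mulr0.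
    by rewrite mevalB !mevalZ !mevalXU mulrC mulrBr; ring.
  (* Since [s] has d - 2 >= m + 2 elements, m of them other than [b] can be chosen; with [b1] and
     [b2] they give the m + 2 zeros that a form of degree m + 1 cannot have on X = 0 unless it
     vanishes there. *)
  pose r := take m (rem b s).
  have rs : {subset r <= s} by move=> c /mem_take /mem_rem.
  have br : b \notin r.
    by apply/negP => /mem_take; rewrite mem_rem_uniq // inE eqxx.
  have sr : size r = m.
    have ms' : (m.+1 < size s)%N by move: md; rewrite -ss.
    apply: size_takel; rewrite (size_rem bs).
    by move: ms'; case: (size s) => [//|k]; rewrite ltnS => /ltnW.
  have [p [pm pb pr]] := prod r rs br; rewrite sr in pm.
  have gm : alpha * p \is m.+1.-homog by exact: (dhomogM (cross_homog _ _) pm).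
  have [h hm hE] := hJ _ gm.
  have : map_poly (horner_eval 0) (dehomog (affine_coords K) h) = 0.
    apply: (@vanish_on_line _ _ [:: b1, b2 & r] hm); last first.
    - move=> c hc; apply/eqP; rewrite (hgv _ _ _ gm hm hE); last first.
        by move: hc; rewrite !inE => /or3P[->|->|/rs ->]; rewrite ?orbT.
      move: hc; rewrite mevalM !inE => /or3P[/eqP ->|/eqP ->|/pr ->]; last by rewrite mulr0.
      + by rewrite cross_meval; apply/eqP; ring.
      + by rewrite cross_meval; apply/eqP; ring.
    - by rewrite /= sr.
    - move: us => /= /and3P[]; rewrite inE negb_or => /andP[h0 h1] h2 _.
      by rewrite inE negb_or h0 (contra (rs _) h1) (contra (rs _) h2) take_uniq // rem_uniq.
  move/(congr1 (horner_eval b)); rewrite /horner_eval horner0 -pt_horner ev2_affine_coords => /eqP.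
  by rewrite [_ == 0](hgv _ _ _ gm hm hE bs') mevalM mulf_eq0 (negPf alphab) (negPf pb).
have x0 : x != 0.
  by have := chart_transcendental d_gt0 ch (negbT (polyX_eq0 K)); rewrite map_polyX hornerX.
have va0 : mmap f v alpha != 0.
  by apply: contraNneq alpha0 => h; apply/eqP/(v_inj d_gt1 (cross_homog _ _)).
exists (J * mmap f v alpha / x); first by rewrite !mulf_neq0 // invr_eq0.
move=> g gm.
have agm : alpha * g \is m.+1.-homog by exact: (dhomogM (cross_homog _ _) gm).
have [h hm hE] := hJ _ agm.
have [|h' h'm h'E] := dvd_X0 hm.
  apply: (vanish_on_line hm us); first by rewrite ss.
  by move=> b bs; apply/eqP; rewrite (hgv _ _ _ agm hm hE) // mevalM alphaE // mul0r.
exists h' => //; apply: (mulfI x0).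
transitivity (mmap f xi h); first by rewrite -hE rmorphM /=; field.
by rewrite h'E rmorphM /= mmapX mmap1U.
Qed.

End Descent.

(** * Birational maps of the Fermat curve *)

Lemma rmorph_mmap n (R S T : comNzRingType) (f : {rmorphism R -> S}) (phi : {rmorphism S -> T})
    (g : R -> T) (v : 'I_n -> S) (p : {mpoly R[n]}) :
  phi \o f =1 g -> phi (mmap f v p) = mmap g (phi \o v) p.
Proof.
move=> hg; rewrite /mmap rmorph_sum; apply: eq_bigr => mu _.
rewrite rmorphM /= -hg; congr (_ * _).
by rewrite /mmap1 rmorph_prod; apply: eq_bigr => i _; rewrite rmorphXn.
Qed.

Lemma mmap_comp n k (R S : comNzRingType) (f : {rmorphism R -> S}) (w : 'I_k -> S)
    (lq : n.-tuple {mpoly R[k]}) (p : {mpoly R[n]}) :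
  mmap f w (p \mPo lq) = mmap f (fun i => mmap f w (tnth lq i)) p.
Proof. by rewrite /comp_mpoly (rmorph_mmap (g := f)) // => c; apply: mmapC. Qed.

Lemma dhomog_comp n k (R : comNzRingType) m e (lq : n.-tuple {mpoly R[k]}) (p : {mpoly R[n]}) :
  p \is m.-homog -> (forall i, tnth lq i \is e.-homog) -> p \mPo lq \is (e * m).-homog.
Proof.
move=> /dhomogP hp hq; rewrite comp_mpolyEX big_seq; apply: rpred_sum => mu /hp hmu.
apply: rpredZ; rewrite comp_mpolyX -hmu -[mf in (e * mf)%N]/(mdeg mu) mdegE big_distrr /=.
elim/big_rec2: _ => [|i p' m' _ h]; first exact: dhomog1.
by apply: dhomogM h; apply: dhomogMn.
Qed.

Section CurveGeneric.
Variables (K : closedFieldType) (charK : [pchar K] =i pred0) (L : fieldType).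
Variables (f : {rmorphism K -> L}) (d : nat) (d_gt1 : (1 < d)%N) (x y : L).
Hypothesis ch : fermat_chart f d x y.
Local Notation xi := (generic_point x y).
Local Notation F := (fermat K d).

Let d_gt0 : (0 < d)%N. Proof. exact: ltnW. Qed.

Lemma mmap_fermat (S : comNzRingType) (g : {rmorphism K -> S}) (v : 'I_3 -> S) :
  mmap g v F = v 0 ^+ d + v 1 ^+ d + v 2 ^+ d.
Proof. by rewrite rmorph_sum /= sum3 !rmorphXn /= !mmapX !mmap1U. Qed.

Lemma meval_fermat (v : 'I_3 -> K) : F.@[v] = v 0 ^+ d + v 1 ^+ d + v 2 ^+ d.
Proof. exact: (mmap_fermat (idfun : {rmorphism K -> K})). Qed.

Lemma fermat_homog : F \is d.-homog.
Proof. by apply: rpred_sum => i _; apply: homogXn. Qed.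

Lemma chart_x_neq0 : x != 0.
Proof. by have := chart_transcendental d_gt0 ch (negbT (polyX_eq0 K)); rewrite map_polyX hornerX. Qed.

(** The dictionary between forms on the curve and elements of [L]. A point with Z nonzero is a
    specialisation of the chart (x, y); a point with Z = 0 has X nonzero and is one of the flipped
    chart. *)
Lemma zero_on_curve_generic k (p : {mpoly K[3]}) : p \is k.-homog ->
  zero_on_curve F p <-> mmap f xi p = 0.
Proof.
move=> hp; split=> [h|h v [v0 hv]].
  rewrite /generic_point -ev2_affine_coords; apply: (pt_eq0_ev charK d_gt1 ch) => x0 y0 on0.
  rewrite ev2_affine_coords.
  pose w : 'rV[K]_3 := \row_i vec3 x0 y0 1 i.
  have wE : w 0 =1 vec3 x0 y0 1 by move=> i; rewrite mxE.
  rewrite -(eq_mmap _ _ wE); apply: h; split.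
    by apply/eqP => /rowP /(_ 2); rewrite !mxE /vec3 /=; apply/eqP/oner_neq0.
  by rewrite meval_fermat !wE /vec3 /= expr1n.
rewrite meval_fermat in hv.
have [v2|v2] := eqVneq (v 0 2) 0; last first.
  have on0 : (v 0 0 / v 0 2) ^+ d + (v 0 1 / v 0 2) ^+ d + 1 = 0.
    rewrite !expr_div_n -mulrDl -(divff (expf_neq0 d v2)) -mulrDl.
    by rewrite hv mul0r.
  have e : v 0 =1 (fun i => v 0 2 * vec3 (v 0 0 / v 0 2) (v 0 1 / v 0 2) 1 i).
    by apply: ord3P; rewrite /vec3 /= ?mulr1 // mulrC divfK.
  rewrite (meval_eq _ e) (meval_scale _ _ hp).
  have := ev_eq0_pt d_gt1 ch (P := dehomog (affine_coords K) p) on0.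
  by rewrite !ev2_affine_coords /meval => /(_ h) ->; rewrite mulr0.
have v00 : v 0 0 != 0.
  apply: contraNneq v0 => v00; apply/eqP/rowP; rewrite v00 v2 expr0n gtn_eqF // addr0 add0r in hv.
  by apply: ord3P; rewrite mxE // -[LHS]/(v 0 1); apply/eqP; move/eqP: hv; rewrite expf_eq0 d_gt0.
have e : v 0 =1 (fun i => v 0 0 * vec3 1 (v 0 1 / v 0 0) 0 i).
  by apply: ord3P; rewrite /vec3 /= ?mulr1 ?mulr0 // mulrC divfK.
rewrite (meval_eq _ e) (meval_scale _ _ hp).
pose t : 'I_3 -> {poly {poly K}} := vec3 1 'X 'X%:P.
have evt (S : comNzRingType) (g : {rmorphism K -> S}) a b : ev2 g a b (dehomog t p) = mmap g (vec3 1 b a) p.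
  rewrite ev2_dehomog; apply: eq_mmap; apply: ord3P => /=.
  - by rewrite ev2_1.
  - by rewrite ev2X.
  - by rewrite ev2CX.
have on0 : 0 ^+ d + (v 0 1 / v 0 0) ^+ d + 1 = 0.
  rewrite expr0n gtn_eqF // add0r expr_div_n -(divff (expf_neq0 d v00)) -mulrDl.
  by move: hv; rewrite v2 expr0n gtn_eqF // addr0 addrC => ->; rewrite mul0r.
have := ev_eq0_pt d_gt1 (chart_flip d_gt0 ch) (P := dehomog t p) on0.
rewrite !evt /meval => -> //; first by rewrite mulr0.
have e' : vec3 1 (y / x) x^-1 =1 (fun i => x^-1 * xi i).
  by apply: ord3P; rewrite /generic_point /vec3 /= ?mulr1 ?mulVf ?chart_x_neq0 // mulrC.
by rewrite (eq_mmap _ _ e') (mmap_scale _ _ _ hp) h mulr0.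
Qed.

Definition generic_value n (phi : n.-tuple {mpoly K[3]}) (i : 'I_n) : L :=
  mmap f xi (tnth phi i).

Lemma is_ratmapP n (phi : n.-tuple {mpoly K[3]}) : is_ratmap F phi <->
  (exists e, forall i, tnth phi i \is e.-homog) /\ (exists i, generic_value phi i != 0).
Proof.
split=> -[[e he] [i hi]]; split; try by exists e.
  by exists i; apply/eqP => h; apply/hi/(zero_on_curve_generic (he i)).
by exists i => /(zero_on_curve_generic (he i)); apply/eqP.
Qed.

Lemma rat_eqP n (phi psi : n.-tuple {mpoly K[3]}) : rat_eq F phi psi <->
  [/\ is_ratmap F phi, is_ratmap F psi & forall i j,
      generic_value phi i * generic_value psi j = generic_value phi j * generic_value psi i].
Proof.
split=> -[h1 h2 h3]; split=> // i j; have [[e1 he1] _] := h1; have [[e2 he2] _] := h2;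
  have hm : tnth phi i * tnth psi j - tnth phi j * tnth psi i \is (e1 + e2).-homog
    by rewrite rpredB // dhomogM.
  move/(zero_on_curve_generic hm): (h3 i j).
  by rewrite rmorphB !rmorphM /= => /eqP; rewrite subr_eq0 => /eqP.
by apply/(zero_on_curve_generic hm); rewrite rmorphB !rmorphM /= h3 subrr.
Qed.

Lemma generic_value_comp n (phi : n.-tuple {mpoly K[3]}) (tau : 3.-tuple {mpoly K[3]}) i :
  generic_value (rat_comp phi tau) i = mmap f (generic_value tau) (tnth phi i).
Proof. by rewrite /generic_value tnth_mktuple mmap_comp. Qed.

Lemma zero_on_curve_comp k (p : {mpoly K[3]}) (tau : 3.-tuple {mpoly K[3]}) :
  p \is k.-homog -> zero_on_curve F p -> zero_on_curve F (F \mPo tau) ->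
  zero_on_curve F (p \mPo tau).
Proof.
move=> hp p0 hF v hv; rewrite comp_mpoly_meval.
pose w : 'rV[K]_3 := \row_i (tnth tau i).@[v 0].
have wE : (fun i => (tnth tau i).@[v 0]) =1 w 0 by move=> i; rewrite mxE.
rewrite (meval_eq _ wE); have [w0|w0] := eqVneq w 0; last first.
  by apply: p0; split=> //; rewrite -(meval_eq _ wE) -comp_mpoly_meval; apply: hF.
(* At a common zero of the entries of [tau], p(w) = 0^k p(v); this is zero also for k = 0, because
   p(v) = 0. *)
have e : w 0 =1 (fun i => 0 * v 0 i) by move=> i; rewrite w0 mxE mul0r.
by rewrite (meval_eq _ e) (meval_scale _ _ hp) p0 ?mulr0.
Qed.

End CurveGeneric.

(** * Birational self-maps at the generic point *)

Section Birational.
Variables (K : closedFieldType) (charK : [pchar K] =i pred0) (L : fieldType).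
Variables (f : {rmorphism K -> L}) (d : nat) (d_gt3 : (3 < d)%N) (x y : L) (D : L -> L).
Hypotheses (ch : fermat_chart f d x y) (hD : fermat_derivation f d x y D).
Local Notation xi := (generic_point x y).
Local Notation F := (fermat K d).
Local Notation val := (generic_value f x y).

Let d_gt1 : (1 < d)%N. Proof. by apply: leq_trans d_gt3. Qed.
Let d_gt0 : (0 < d)%N. Proof. exact: ltnW. Qed.

Variables (tau sigma : 3.-tuple {mpoly K[3]}) (hts : mutually_inverse F tau sigma).
Local Notation v := (val tau).

Lemma selfmap_fermat t : is_selfmap F t ->
  val t 0 ^+ d + val t 1 ^+ d + val t 2 ^+ d = 0.
Proof.
move=> [[[e he] _] hF]; rewrite -(mmap_fermat d f) -mmap_comp.
exact/(zero_on_curve_generic charK d_gt1 ch (dhomog_comp (fermat_homog K d) he)).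
Qed.

Lemma parallel_generic (w : 'I_3 -> L) :
  (exists i, w i != 0) -> (forall i j, w i * xi j = w j * xi i) ->
  w 2 != 0 /\ forall i, w i = w 2 * xi i.
Proof.
move=> [i wi] hw; have wE j : w j = w 2 * xi j by rewrite -hw /generic_point /vec3 /= mulr1.
by split=> //; apply: contraNneq wi => w2; rewrite wE w2 mul0r.
Qed.

Lemma rat_id_value i : val (rat_id K) i = xi i.
Proof. by rewrite /generic_value tnth_mktuple mmapX mmap1U. Qed.

Lemma inverse_parallel t : rat_eq F t (rat_id K) ->
  val t 2 != 0 /\ forall i, val t i = val t 2 * xi i.
Proof.
move=> /(rat_eqP charK d_gt1 ch) [/(is_ratmapP charK d_gt1 ch) [_ h1] _ h2].
by apply: parallel_generic => // i j; have := h2 i j; rewrite !rat_id_value.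
Qed.

(** Composition with the inverse [sigma] carries the vanishing of g at the image point back to the
    generic point, where no nonzero form of degree less than [d] vanishes. *)
Lemma birational_inj m (g : {mpoly K[3]}) :
  (m < d)%N -> g \is m.-homog -> mmap f v g = 0 -> g = 0.
Proof.
move=> md gm h; have [[[[e he] _] _] [_ hs] hid _] := hts.
have hgt : g \mPo tau \is (e * m).-homog by exact: dhomog_comp.
have /(zero_on_curve_generic charK d_gt1 ch hgt) z : mmap f xi (g \mPo tau) = 0.
  by rewrite mmap_comp.
have [[[e' he'] _] _] : is_selfmap F sigma by case: hts.
have hgts : (g \mPo tau) \mPo sigma \is (e' * (e * m)).-homog by exact: dhomog_comp.
have := zero_on_curve_comp hgt z hs.
move/(zero_on_curve_generic charK d_gt1 ch hgts); rewrite !mmap_comp.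
have [c0 hc] := inverse_parallel hid.
have -> : mmap f (fun i => mmap f (fun j => mmap f xi (tnth sigma j)) (tnth tau i)) g
   = mmap f (fun i => val (rat_comp tau sigma) 2 * xi i) g.
  by apply: eq_mmap => i; rewrite -hc generic_value_comp.
rewrite (mmap_scale _ _ _ gm) => /eqP; rewrite mulf_eq0 expf_eq0 (negPf c0) andbF /= => /eqP.
exact: (mmap_generic_eq0 ch gm md).
Qed.

Lemma birational_neq0 i : v i != 0.
Proof.
apply/eqP => vi; have X0 : 'X_i = 0 :> {mpoly K[3]}.
  by apply: (birational_inj d_gt1 (homogX K i)); rewrite mmapX mmap1U.
by move/(congr1 (meval (fun=> 1))): X0; rewrite mevalXU meval0; apply/eqP/oner_neq0.
Qed.

(** Otherwise all Wronskians of the coordinates vanish and D kills every ratio of coordinates of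
    [tau]. Through [sigma] it then kills x, whereas D x = y^(d-1) is nonzero. *)
Lemma birational_pullback_neq0 : pullback_factor d D v != 0.
Proof.
have hF : v 0 ^+ d + v 1 ^+ d + v 2 ^+ d = 0 by apply: selfmap_fermat; case: hts.
have v0 := birational_neq0.
rewrite /pullback_factor mulf_neq0 ?invr_eq0 ?expf_neq0 //; apply/eqP => w01.
have w12 : wronskian D (v 1) (v 2) = 0.
  have := wronskian_cyclic charK d_gt1 hD (v0 0) (v0 2) hF; rewrite w01 mul0r => /esym/eqP.
  by rewrite mulf_eq0 invr_eq0 expf_eq0 (negPf (v0 _)) andbF orbF => /eqP.
have w20 : wronskian D (v 2) (v 0) = 0.
  have hF' : v 1 ^+ d + v 2 ^+ d + v 0 ^+ d = 0 by rewrite -hF; ring.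
  have := wronskian_cyclic charK d_gt1 hD (v0 1) (v0 0) hF'; rewrite w12 mul0r => /esym/eqP.
  by rewrite mulf_eq0 invr_eq0 expf_eq0 (negPf (v0 _)) andbF orbF => /eqP.
have DE u w : u * D w - w * D u = 0 -> w != 0 -> D (u / w) = 0.
  move=> h w0; rewrite (fderivM hD) (fderivV hD) //.
  have e : D u * w^-1 + u * (- D w / w ^+ 2) = - (u * D w - w * D u) / w ^+ 2 by field.
  by rewrite e h oppr0 mul0r.
have Dv i : D (v i / v 2) = 0.
  move: i; apply: ord3P; apply: DE => //.
  - by rewrite -[RHS]oppr0 -w20 /wronskian; ring.
  - by rewrite subrr.
have Dg g : D (mmap f (fun i => v i / v 2) g) = 0.
  rewrite /mmap; elim/big_rec: _ => [|mu u _ hu]; first exact: fderiv0 hD.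
  rewrite (fderivD hD) hu addr0 (fderivM hD) (fderivC hD) mul0r add0r /mmap1.
  suff -> : D (\prod_(i < 3) (v i / v 2) ^+ mu i) = 0 by rewrite mulr0.
  elim/big_rec: _ => [|i w _ hw]; first exact: fderiv1 hD.
  rewrite (fderivM hD) hw mulr0 addr0; case: (mu i) => [|n].
    by rewrite expr0 (fderiv1 hD) mul0r.
  by rewrite (fderivXn hD) Dv mulr0 mul0r.
have [_ [[[e he] _] _] _ hid] := hts.
have [c0 hc] := inverse_parallel hid.
pose q i := mmap f (fun i => v i / v 2) (tnth sigma i).
have qE i : val (rat_comp sigma tau) i = v 2 ^+ e * q i.
  rewrite generic_value_comp /q -(mmap_scale _ _ _ (he i)); apply: eq_mmap => j.
  by rewrite mulrC divfK.
have q2 : q 2 != 0 by move: c0; rewrite qE mulf_eq0 negb_or => /andP[].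
have q0 : q 0 = q 2 * x.
  apply: (mulfI (expf_neq0 e (v0 2))); rewrite mulrA -!qE hc //.
have : D (q 0) = 0 by exact: Dg.
rewrite q0 (fderivM hD) [D (q 2)]Dg mul0r add0r (fderivX hD) => /eqP.
by rewrite mulf_eq0 (negPf q2) expf_eq0 (negPf (chart_y_neq0 d_gt1 ch)) andbF.
Qed.

Lemma birational_pulls_back : exists2 J, J != 0 & pulls_back f x y v 1 J.
Proof.
have hF : v 0 ^+ d + v 1 ^+ d + v 2 ^+ d = 0 by apply: selfmap_fermat; case: hts.
(* The differentials have degree d - 3 = m + 1, so the bound of the descent holds with equality at
   its start. *)
have [m dE] : exists m, d = m.+4 by exists (d - 4)%N; rewrite -addn4 subnK.
suff main n : (n.+4 <= d)%N -> forall J, J != 0 -> pulls_back f x y v n.+1 J ->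
    exists2 J', J' != 0 & pulls_back f x y v 1 J'.
  have hm : (m.+4 <= d)%N by rewrite dE.
  apply: (main m hm _ birational_pullback_neq0).
  move=> g gm; have [R -> hR] := pullback_holomorphic charK d_gt1 dE birational_neq0 hF gm ch hD.
  exact: (form_of_affine f x y hR).
elim: n => [|n IH] nd J J0 hJ; first by exists J.
have [J' J'0 hJ'] := pulls_back_descent charK d_gt1 ch birational_neq0 birational_inj nd J0 hJ.
by apply: (IH _ J') => //; apply: ltnW.
Qed.

End Birational.

(** * Linear automorphisms of the Fermat form *)

Lemma coef_dehomog_gt (K : comNzRingType) m (p : {mpoly K[3]}) a b :
  p \is m.-homog -> (m < a + b)%N -> (dehomog (affine_coords K) p)`_a`_b = 0.
Proof.
move=> /dhomogP hp hab; rewrite /dehomog /mmap coef_sum coef_sum big_seq big1 // => mu /hp hmu.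
have {}hmu : mdeg mu = m := hmu.
rewrite /mmap1 prod3 /affine_coords /vec3 /= expr1n mulr1.
rewrite mulrA -polyC_exp -polyCM coefCM coefXn mulr_natr.
have [e1|] := eqVneq a (mu 1); last by rewrite mulr0n coef0.
rewrite mulr1n coefCM coefXn; have [e0|] := eqVneq b (mu 0); last by rewrite mulr0.
by move: hab; rewrite e1 e0 addnC -hmu mdegE sum3n ltnNge leq_addr.
Qed.

Section LinearPart.
Variables (K : closedFieldType) (charK : [pchar K] =i pred0) (d : nat) (d_gt2 : (2 < d)%N).
Local Notation F := (fermat K d).

Let d_gt1 : (1 < d)%N. Proof. exact: ltnW. Qed.
Let d_gt0 : (0 < d)%N. Proof. exact: ltnW. Qed.

(** Subtracting the multiple of F with the same coefficient of Y^d leaves degree less than [d] in Y,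
    where evaluation at the generic point is injective. *)
Lemma form_degree_d (L : fieldType) (f : {rmorphism K -> L}) (x y : L) (P : {mpoly K[3]}) :
  fermat_chart f d x y -> P \is d.-homog ->
  mmap f (generic_point x y) P = 0 -> exists c, P = c *: F.
Proof.
move=> ch hP P0; pose mu : 'X_{1..3} := (U_(1%R) *+ d)%MM.
have muE (i : 'I_3) : mu i = ((i == 1%R) * d)%N by rewrite mulmnE mnm1E eq_sym.
have hmu : mdeg mu = d by rewrite mdegMn mdeg1 mul1n.
exists P@_mu; apply/eqP; rewrite -subr_eq0; apply/eqP.
have hP' : P - P@_mu *: F \is d.-homog by rewrite rpredB // rpredZ // fermat_homog.
apply: (dehomog_eq0 hP'); apply: (chart_free ch).
  apply/leq_sizeP => j; rewrite leq_eqVlt => /orP[/eqP <-|hj]; last first.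
    by rewrite nth_default // (leq_trans (size_dehomog hP')).
  apply/polyP => b; rewrite coef0; case: b => [|b]; last first.
    by rewrite (coef_dehomog_gt hP') // addnS ltnS leq_addr.
  have := coef_dehomog hP' hmu; rewrite !muE /= mul1n => ->.
  rewrite mcoeffB mcoeffZ /fermat raddf_sum /= sum3 !mcoeffXn.
  have muU (i : 'I_3) : ((U_(i) *+ d)%MM == mu) = (i == 1%R).
    apply/eqP/eqP => [/mnmP/(_ i)|->//]; rewrite muE mulmnE mnm1E eqxx mul1n.
    by case: eqP => // _ d0; move: d_gt0; rewrite d0.
  by rewrite !muU /= add0r addr0 mulr1 subrr.
rewrite ev2_affine_coords mmapB mmapZ.
rewrite -/(generic_point x y) P0 mmap_fermat /generic_point /vec3 /= expr1n (chart_eq ch).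
by rewrite mulr0 subr0.
Qed.

Lemma deriv_affine_exp (a b : K) n :
  (((a%:P + b *: 'X) ^+ n.+1)^`()).[0] = n.+1%:R * b * a ^+ n.
Proof.
rewrite deriv_exp derivD derivC derivZ derivX add0r /= hornerMn hornerM hornerZ hornerC.
rewrite horner_exp hornerD hornerC hornerZ hornerX mulr0 addr0 mulr1 -mulr_natl; ring.
Qed.

Lemma deriv_sum (P : 'I_3 -> {poly K}) : (\sum_l P l)^`() = \sum_l (P l)^`().
Proof. exact: (raddf_sum (@deriv K)). Qed.

Lemma poly_fun_deriv0 (p : {poly K}) : (forall s, p.[s] = 0) -> p^`().[0] = 0.
Proof. by move=> /poly_zero_closed ->; rewrite deriv0 horner0. Qed.

(* The entry product is read off the coefficient of [s r] in the identity at
   [w = u + s e_i + r e_k], where [u A = e_j]. *)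
Lemma fermat_automorphism_entries (A : 'M[K]_3) (c : K) : A \in unitmx ->
  (forall w : 'rV[K]_3, \sum_j (w *m A) 0 j ^+ d = c * \sum_i w 0 i ^+ d) ->
  forall i k j, i != k -> A i j * A k j = 0.
Proof.
move=> uA hA i k j ik.
(* After the two derivatives the exponent d - 2 is still positive, so on the left only the term l =
   j survives at zero. On the right no term involves both s and r, as i and k differ. *)
have [n dE] : exists n, d = n.+3 by exists (d - 3)%N; rewrite -addn3 subnK.
pose u : 'rV[K]_3 := delta_mx 0 j *m invmx A.
have key s r : \sum_l ((l == j)%:R + s * A i l + r * A k l) ^+ d =
    c * \sum_l (u 0 l + s * (l == i)%:R + r * (l == k)%:R) ^+ d.
  have := hA (u + s *: delta_mx 0 i + r *: delta_mx 0 k).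
  rewrite !mulmxDl -!scalemxAl mulmxKV // -!rowE => h.
  transitivity (\sum_l ((delta_mx 0 j + s *: row i A + r *: row k A : 'rV[K]_3) 0 l) ^+ d).
    by apply: eq_bigr => l _; rewrite !mxE.
  by rewrite h; congr (_ * _); apply: eq_bigr => l _; rewrite !mxE !eqxx.
have step1 r : \sum_l A i l * ((l == j)%:R + r * A k l) ^+ n.+2 = c * u 0 i ^+ n.+2.
  pose p : {poly K} := \sum_l (((l == j)%:R + r * A k l)%:P + A i l *: 'X) ^+ n.+3
     - c *: \sum_l ((u 0 l + r * (l == k)%:R)%:P + (l == i)%:R *: 'X) ^+ n.+3.
  have p0 s : p.[s] = 0.
    rewrite hornerD hornerN hornerZ !horner_sum; apply/eqP; rewrite subr_eq0; apply/eqP.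
    have := key s r; rewrite dE => h; rewrite [RHS](_ : _ = c * \sum_l (u 0 l + s * (l == i)%:R + r * (l == k)%:R) ^+ n.+3).
      by rewrite -h; apply: eq_bigr => l _; rewrite horner_exp !hornerE; congr (_ ^+ _); ring.
    by congr (_ * _); apply: eq_bigr => l _; rewrite horner_exp !hornerE; congr (_ ^+ _); ring.
  have e1 : \sum_l ((((l == j)%:R + r * A k l)%:P + A i l *: 'X) ^+ n.+3)^`().[0]
      = n.+3%:R * \sum_l A i l * ((l == j)%:R + r * A k l) ^+ n.+2.
    by rewrite mulr_sumr; apply: eq_bigr => l _; rewrite deriv_affine_exp mulrA.
  have e2 : \sum_l (((u 0 l + r * (l == k)%:R)%:P + (l == i)%:R *: 'X) ^+ n.+3)^`().[0]
      = n.+3%:R * u 0 i ^+ n.+2.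
    rewrite (bigD1 i) //= big1 => [|l li]; last by rewrite deriv_affine_exp (negPf li) mulr0 mul0r.
    by rewrite deriv_affine_exp eqxx (negPf ik) mulr0 addr0 mulr1 addr0.
  have := poly_fun_deriv0 p0; rewrite derivB derivZ !deriv_sum hornerD hornerN hornerZ !horner_sum.
  rewrite e1 e2 mulrCA -mulrBr => /eqP.
  by rewrite mulf_eq0 (negPf (natr_neq0_pchar0 charK _)) //= subr_eq0 => /eqP.
pose q : {poly K} := \sum_l A i l *: (((l == j)%:R)%:P + A k l *: 'X) ^+ n.+2
  - (c * u 0 i ^+ n.+2)%:P.
have q0 r : q.[r] = 0.
  rewrite hornerD hornerN hornerC -(step1 r) horner_sum; apply/eqP; rewrite subr_eq0; apply/eqP.
  by apply: eq_bigr => l _; rewrite hornerZ horner_exp !hornerE [r * _]mulrC.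
have := poly_fun_deriv0 q0; rewrite derivB derivC subr0 deriv_sum horner_sum (bigD1 j) //=.
rewrite big1; last first.
  by move=> l lj; rewrite derivZ hornerZ deriv_affine_exp (negPf lj) exprS mul0r !mulr0.
rewrite addr0 derivZ hornerZ deriv_affine_exp eqxx expr1n mulr1 mulrCA => /eqP.
by rewrite mulf_eq0 (negPf (natr_neq0_pchar0 charK _)) //= => /eqP.
Qed.

(** A column has at most one nonzero entry because products of two entries vanish, and at least one
    by invertibility. Two columns with this entry in the same row would be proportional. The basis
    vectors give the d-th powers of the entries. *)
Lemma fermat_automorphism_monomial (A : 'M[K]_3) (c : K) : A \in unitmx ->
  (forall w : 'rV[K]_3, \sum_j (w *m A) 0 j ^+ d = c * \sum_i w 0 i ^+ d) ->
  exists s : {perm 'I_3}, forall j, A (s j) j ^+ d = c /\ forall i, i != s j -> A i j = 0.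
Proof.
move=> uA hA; have ent := fermat_automorphism_entries uA hA.
have colnz j : exists i, A i j != 0.
  apply: NNPP => hno; have : col j A = 0.
    apply/colP => i; rewrite !mxE; apply/eqP; apply: contraT => h; case: hno; by exists i.
  rewrite colE => /(congr1 (mulmx (invmx A))); rewrite mulmxA mulVmx // mul1mx mulmx0.
  by move/colP/(_ j); rewrite !mxE !eqxx; apply/eqP/oner_neq0.
pose s0 (j : 'I_3) := xchoose (colnz j).
have s0P j : A (s0 j) j != 0 := xchooseP (colnz j).
have sz j i : i != s0 j -> A i j = 0.
  by move=> ij; have /eqP := ent _ _ j ij; rewrite mulf_eq0 (negPf (s0P j)) orbF => /eqP.
have s0_inj : injective s0.
  move=> j j' e; apply/eqP; apply: contraT => jj'.
  have hc : A *m (A (s0 j) j' *: delta_mx j 0 - A (s0 j) j *: delta_mx j' 0 : 'cV_3) = 0.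
    rewrite mulmxBr -!scalemxAr -!colE; apply/colP => i; rewrite !mxE.
    have [->|ne] := eqVneq i (s0 j); first by rewrite mulrC subrr.
    by rewrite (sz j i) // (sz j' i) ?mulr0 ?subr0 // -e.
  move/(congr1 (mulmx (invmx A))): hc; rewrite mulmxA mulVmx // mul1mx mulmx0.
  move/colP/(_ j); rewrite !mxE !eqxx (negPf jj') mulr1 mulr0 subr0 => h.
  by have := s0P j'; rewrite -e h eqxx.
exists (perm s0_inj) => j; rewrite permE; split; last exact: sz.
have := hA (delta_mx 0 (s0 j)); rewrite -rowE (bigD1 j) //= mxE big1; last first.
  move=> l lj; rewrite mxE (sz l) ?expr0n ?gtn_eqF //.
  by apply: contra_neq lj => /s0_inj.
rewrite addr0 => ->; rewrite (bigD1 (s0 j)) //= mxE !eqxx expr1n big1 ?addr0 ?mulr1 //.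
by move=> l lj; rewrite mxE (negPf lj) andbF expr0n gtn_eqF.
Qed.

End LinearPart.

(** * Monomial maps up to equality of rational maps *)

Definition monomial_map (K : closedFieldType) (s : {perm 'I_3}) (a : 'I_3 -> K) :
  3.-tuple {mpoly K[3]} := [tuple a j *: 'X_(s j) | j < 3].

Lemma linear_formE (K : comNzRingType) (h : {mpoly K[3]}) : h \is 1.-homog ->
  h = \sum_(k < 3) h@_U_(k) *: 'X_k.
Proof.
move=> hh; apply/mpolyP => mu; rewrite raddf_sum /=.
rewrite (eq_bigr (fun k : 'I_3 => h@_U_(k) * (U_(k)%MM == mu)%:R)); last first.
  by move=> k _; rewrite mcoeffZ mcoeffX.
have [/eqP/mdeg1P [i /eqP ->]|hmu] := eqVneq (mdeg mu) 1%N.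
  rewrite (bigD1 i) //= eqxx mulr1 big1 ?addr0 // => k /negPf ki.
  by rewrite eq_mnm1 ki mulr0.
rewrite (dhomog_nemf_coeff hh hmu) big1 // => k _.
by case: eqP => [e|_]; [move: hmu; rewrite -e mdeg1 | rewrite mulr0].
Qed.

Section MonomialMaps.
Variables (K : closedFieldType) (charK : [pchar K] =i pred0) (L : fieldType).
Variables (f : {rmorphism K -> L}) (d : nat) (d_gt3 : (3 < d)%N) (x y : L) (D : L -> L).
Hypotheses (ch : fermat_chart f d x y) (hD : fermat_derivation f d x y D).
Local Notation xi := (generic_point x y).
Local Notation F := (fermat K d).
Local Notation val := (generic_value f x y).

Let d_gt2 : (2 < d)%N. Proof. by apply: leq_trans d_gt3. Qed.
Let d_gt1 : (1 < d)%N. Proof. by apply: leq_trans d_gt3. Qed.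
Let d_gt0 : (0 < d)%N. Proof. exact: ltnW. Qed.

Let ratmapP := (@is_ratmapP _ charK _ _ _ d_gt1 _ _ ch).
Let rateqP := (@rat_eqP _ charK _ _ _ d_gt1 _ _ ch).
Let zeroP := (@zero_on_curve_generic _ charK _ _ _ d_gt1 _ _ ch).

Lemma generic_point_neq0 i : xi i != 0.
Proof.
move: i; apply: ord3P; rewrite /generic_point /vec3 /= ?oner_neq0 //.
  exact: (chart_x_neq0 d_gt1 ch).
exact: (chart_y_neq0 d_gt1 ch).
Qed.

Lemma rat_eq_refl n (phi : n.-tuple {mpoly K[3]}) : is_ratmap F phi -> rat_eq F phi phi.
Proof. by move=> h; apply/rateqP; split=> // i j; rewrite mulrC. Qed.

Lemma rat_eq_sym n (phi psi : n.-tuple {mpoly K[3]}) : rat_eq F phi psi -> rat_eq F psi phi.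
Proof.
by move=> /rateqP [h1 h2 h3]; apply/rateqP; split=> // i j; rewrite mulrC -h3 mulrC.
Qed.

Lemma rat_eq_scaleP n (phi psi : n.-tuple {mpoly K[3]}) : rat_eq F phi psi <->
  [/\ is_ratmap F phi, is_ratmap F psi &
      exists2 c, c != 0 & forall i, val phi i = c * val psi i].
Proof.
split=> [/rateqP [h1 h2 h3]|[h1 h2 [c c0 hc]]]; last first.
  by apply/rateqP; split=> // i j; rewrite !hc; ring.
split=> //; have /ratmapP [_ [i0 p0]] := h1; have /ratmapP [_ [j0 q0]] := h2.
have hphi i : val phi i = val phi j0 / val psi j0 * val psi i.
  by rewrite mulrAC -h3 mulfK.
exists (val phi j0 / val psi j0) => //; apply: contraNneq p0 => h.
by rewrite hphi h mul0r.
Qed.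

Lemma rat_eq_trans n (phi psi chi : n.-tuple {mpoly K[3]}) :
  rat_eq F phi psi -> rat_eq F psi chi -> rat_eq F phi chi.
Proof.
move=> /rat_eq_scaleP [h1 h2 [c c0 hc]] /rat_eq_scaleP [_ h3 [c' c0' hc']].
apply/rat_eq_scaleP; split=> //; exists (c * c'); rewrite ?mulf_neq0 // => i.
by rewrite hc hc' mulrA.
Qed.

Lemma monomial_value s (a : 'I_3 -> K) j : val (monomial_map s a) j = f (a j) * xi (s j).
Proof. by rewrite /generic_value tnth_mktuple mmapZ mmapX mmap1U. Qed.

Lemma monomial_homog s (a : 'I_3 -> K) j : tnth (monomial_map s a) j \is 1.-homog.
Proof. by rewrite tnth_mktuple rpredZ // homogX. Qed.

Lemma unity_neq0 (c : K) : c ^+ d = 1 -> c != 0.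
Proof.
by apply: contra_eq_neq => ->; rewrite expr0n gtn_eqF // eq_sym oner_neq0.
Qed.

Lemma monomial_ratmap s (a : 'I_3 -> K) : (forall j, a j ^+ d = 1) -> is_ratmap F (monomial_map s a).
Proof.
move=> ha; apply/ratmapP; split; first by exists 1%N; apply: monomial_homog.
by exists 0; rewrite monomial_value mulf_neq0 ?fmorph_eq0 ?generic_point_neq0 ?unity_neq0.
Qed.

Lemma monomial_comp s t (a b : 'I_3 -> K) :
  rat_comp (monomial_map s a) (monomial_map t b) = monomial_map (s * t)%g (fun j => a j * b (s j)).
Proof.
apply: eq_from_tnth => i; rewrite !tnth_mktuple comp_mpolyZ comp_mpolyXU -tnth_nth tnth_mktuple.
by rewrite scalerA permM.
Qed.

Lemma monomial_id : monomial_map 1%g (fun=> 1) = rat_id K.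
Proof. by apply: eq_from_tnth => i; rewrite !tnth_mktuple scale1r perm1. Qed.

Lemma eq_monomial s (a b : 'I_3 -> K) : a =1 b -> monomial_map s a = monomial_map s b.
Proof. by move=> ab; apply: eq_from_tnth => i; rewrite !tnth_mktuple ab. Qed.

Lemma monomial_selfmap s (a : 'I_3 -> K) : (forall j, a j ^+ d = 1) -> is_selfmap F (monomial_map s a).
Proof.
move=> ha; split; first exact: monomial_ratmap.
apply/(zeroP (dhomog_comp (fermat_homog K d) (monomial_homog s a))).
rewrite mmap_comp mmap_fermat -(sum3 (fun i => (mmap f xi (tnth (monomial_map s a) i)) ^+ d)).
rewrite (eq_bigr (fun i => xi (s i) ^+ d)); last first.
  by move=> i _; rewrite -[mmap _ _ _]/(val _ i) monomial_value exprMn -rmorphXn ha rmorph1 mul1r.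
transitivity (\sum_(i < 3) xi i ^+ d); first by rewrite [RHS](reindex_inj (@perm_inj _ s)).
by rewrite sum3 /generic_point /vec3 /= expr1n (chart_eq ch).
Qed.

Definition unity_inverse (s : {perm 'I_3}) (a : 'I_3 -> K) j := (a (s^-1%g j))^-1.

Lemma unity_inverseP s (a : 'I_3 -> K) : (forall j, a j ^+ d = 1) ->
  forall j, unity_inverse s a j ^+ d = 1.
Proof. by move=> ha j; rewrite exprVn ha invr1. Qed.

Lemma monomial_invr s (a : 'I_3 -> K) : (forall j, a j ^+ d = 1) ->
  rat_comp (monomial_map s a) (monomial_map s^-1%g (unity_inverse s a)) = rat_id K.
Proof.
move=> ha; rewrite monomial_comp mulgV -monomial_id; apply: eq_monomial => j.
by rewrite /unity_inverse permK divff // unity_neq0.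
Qed.

Lemma monomial_invl s (a : 'I_3 -> K) : (forall j, a j ^+ d = 1) ->
  rat_comp (monomial_map s^-1%g (unity_inverse s a)) (monomial_map s a) = rat_id K.
Proof.
move=> ha; rewrite monomial_comp mulVg -monomial_id; apply: eq_monomial => j.
by rewrite /unity_inverse mulVf // unity_neq0.
Qed.

Lemma monomial_regular s (a : 'I_3 -> K) : (forall j, a j ^+ d = 1) -> regular F (monomial_map s a).
Proof.
move=> ha v [v0 _]; exists (monomial_map s a); first exact/rat_eq_refl/monomial_ratmap.
have [k vk] : exists k, v 0 k != 0 by apply/existsP; rewrite -negb_forall; apply: contra v0 =>
  /forallP h; apply/eqP/rowP => k; rewrite mxE; apply/eqP/h.
exists (s^-1%g k); rewrite tnth_mktuple mevalZ mevalXU permKV mulf_neq0 //.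
exact: unity_neq0.
Qed.

(** The delicate point is that the composite does not vanish identically on the curve: composing
    with the inverse monomial map would carry such a vanishing back to an entry of [tau] that is
    nonzero at the generic point. *)
Lemma rat_comp_monomial tau sigma s t (a b : 'I_3 -> K) :
  (forall j, a j ^+ d = 1) -> (forall j, b j ^+ d = 1) ->
  rat_eq F tau (monomial_map s a) -> rat_eq F sigma (monomial_map t b) ->
  rat_eq F (rat_comp tau sigma) (monomial_map (s * t)%g (fun j => a j * b (s j))).
Proof.
move=> ha hb ht /rat_eq_scaleP [[[e' he'] _] _ [c c0 hc]].
have [[[e he] _] _ hm] := ht; have /rateqP [/ratmapP [_ [i0 ti0]] _ _] := ht.
have hab j : (a j * b (s j)) ^+ d = 1 by rewrite exprMn ha hb mulr1.
have valE i : val (rat_comp tau sigma) i = c ^+ e * mmap f (val (monomial_map t b)) (tnth tau i).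
  by rewrite generic_value_comp -(mmap_scale _ _ _ (he i)); apply: eq_mmap.
have [_ hF] := monomial_selfmap t hb.
apply/rateqP; split; [apply/ratmapP; split| exact: monomial_ratmap |].
- by exists (e' * e)%N => i; rewrite tnth_mktuple; apply: dhomog_comp.
- exists i0; apply: contraNneq ti0; rewrite valE => /eqP.
  rewrite mulf_eq0 expf_eq0 (negPf c0) andbF /= => /eqP h.
  have hom1 := dhomog_comp (he i0) (monomial_homog t b).
  have /(zeroP hom1) z : mmap f xi (tnth tau i0 \mPo monomial_map t b) = 0 by rewrite mmap_comp.
  have [_ hF'] := monomial_selfmap t^-1%g (unity_inverseP t hb).
  have hom2 := dhomog_comp hom1 (monomial_homog t^-1%g (unity_inverse t b)).
  have /(zeroP hom2) := zero_on_curve_comp hom1 z hF'.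
  rewrite !mmap_comp => h'; apply/eqP; rewrite -[RHS]h'; apply: eq_mmap => j.
  by rewrite -(generic_value_comp f x y) monomial_invr // rat_id_value.
move=> i j; have hij : tnth tau i * tnth (monomial_map s a) j - tnth tau j * tnth (monomial_map s a) i
    \is (e + 1).-homog by rewrite rpredB // dhomogM // monomial_homog.
have /(zeroP (dhomog_comp hij (monomial_homog t b))) := zero_on_curve_comp hij (hm i j) hF.
rewrite mmap_comp rmorphB !rmorphM /= => /eqP; rewrite subr_eq0 => /eqP.
move=> e0; rewrite -monomial_comp !valE !generic_value_comp -!mulrA; congr (_ * _); exact: e0.
Qed.

Lemma rat_comp_monomial_inverse (tau : 3.-tuple {mpoly K[3]}) s (a : 'I_3 -> K) : (forall j, a j ^+ d = 1) ->
  rat_eq F tau (monomial_map s a) ->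
  rat_eq F (rat_comp tau (monomial_map s^-1%g (unity_inverse s a))) (rat_id K) /\
  rat_eq F (rat_comp (monomial_map s^-1%g (unity_inverse s a)) tau) (rat_id K).
Proof.
move=> ha ht; have ha' := unity_inverseP s ha.
have hr := rat_eq_refl (monomial_ratmap s^-1%g ha').
split; first by rewrite -(monomial_invr s ha) monomial_comp; apply: rat_comp_monomial.
by rewrite -(monomial_invl s ha) monomial_comp; apply: rat_comp_monomial.
Qed.

Lemma monomial_Aut tau s (a : 'I_3 -> K) : (forall j, a j ^+ d = 1) ->
  rat_eq F tau (monomial_map s a) -> Aut_curve F tau.
Proof.
move=> ha ht; have ha' := unity_inverseP s ha.
exists (monomial_map s^-1%g (unity_inverse s a)).
have [h1 h2] := rat_comp_monomial_inverse ha ht.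
have /rat_eq_scaleP [[[e he] r0] hm [c c0 hc]] := ht.
split; last exact: monomial_regular; last first.
  move=> w hw; have [phi h3 h4] := monomial_regular s ha hw.
  by exists phi => //; apply: rat_eq_trans h3 (rat_eq_sym ht).
split=> //; last exact: monomial_selfmap.
split; first by split=> //; exists e.
apply/(zeroP (dhomog_comp (fermat_homog K d) he)).
have [_ /(zeroP (dhomog_comp (fermat_homog K d) (monomial_homog s a)))] := monomial_selfmap s ha.
rewrite !mmap_comp => h.
rewrite (eq_mmap f (w := fun i => c * val (monomial_map s a) i)) //.
by rewrite (mmap_scale _ _ _ (fermat_homog K d)) [X in _ * X]h mulr0.
Qed.

(** The factor [J] of degree 1 makes the coordinates of [tau] linear forms, with matrix [A]. A
    relation between the columns of [A] would put the image of the generic point on a line, so [A]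
    is invertible; F composed with it has degree d and vanishes at the generic point, hence is a
    multiple of F. *)
Lemma birational_monomial tau : Bir_curve F tau ->
  exists (s : {perm 'I_3}) (a : 'I_3 -> K), (forall j, a j ^+ d = 1) /\ rat_eq F tau (monomial_map s a).
Proof.
move=> [sigma hts]; have [J J0 hJ] := birational_pulls_back charK d_gt3 ch hD hts.
have v0 := birational_neq0 charK d_gt3 ch hts.
have [h hh] : exists h : 'I_3 -> {mpoly K[3]}, forall i, h i \is 1.-homog /\ val tau i * J = mmap f xi (h i).
  have tot i : exists h : {mpoly K[3]}, h \is 1.-homog /\ val tau i * J = mmap f xi h.
    by have [h h1 h2] := hJ _ (homogX K i); exists h; split=> //; rewrite -h2 mmapX mmap1U.
  exists (fun i => proj1_sig (constructive_indefinite_description _ (tot i))) => i.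
  exact: (proj2_sig (constructive_indefinite_description _ (tot i))).
have hh1 i : h i \is 1.-homog by case: (hh i).
pose A : 'M[K]_3 := \matrix_(k, i) (h i)@_U_(k).
have hE (S : comNzRingType) (g : {rmorphism K -> S}) w i :
    mmap g w (h i) = \sum_k g (A k i) * w k.
  rewrite {1}(linear_formE (hh1 i)) raddf_sum; apply: eq_bigr => k _.
  by rewrite /= mmapZ mmapX mmap1U mxE.
have vE i : val tau i * J = \sum_k f (A k i) * xi k by rewrite -hE; case: (hh i).
have uA : A \in unitmx.
  rewrite unitmxE unitfE -det_tr; apply/negP => /det0P [u u0 hu].
  pose g : {mpoly K[3]} := \sum_j u 0 j *: 'X_j.
  have g1 : g \is 1.-homog by apply: rpred_sum => j _; rewrite rpredZ // homogX.
  have g0 : g = 0.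
    apply: (birational_inj charK d_gt3 ch hts d_gt1 g1); apply: (mulIf J0); rewrite mul0r.
    rewrite raddf_sum mulr_suml /=.
    rewrite (eq_bigr (fun j => \sum_k f (u 0 j * A k j) * xi k)); last first.
      move=> j _; rewrite mmapZ mmapX mmap1U -mulrA vE mulr_sumr.
      by apply: eq_bigr => k _; rewrite rmorphM mulrA.
    rewrite exchange_big big1 // => k _ /=; rewrite -mulr_suml -rmorph_sum.
    move/rowP/(_ k): hu; rewrite mxE [RHS]mxE => hu.
    rewrite (eq_bigr (fun j => u 0 j * A^T j k)) => [|j _]; last by rewrite [in RHS]mxE.
    by rewrite hu rmorph0 mul0r.
  case/eqP: u0; apply/rowP => k; rewrite mxE.
  have := congr1 (mcoeff U_(k)) g0; rewrite mcoeff0 raddf_sum (bigD1 k) //= big1 ?addr0.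
    by rewrite mcoeffZ mcoeffXU eqxx mulr1.
  by move=> j jk; rewrite mcoeffZ mcoeffXU (negPf jk) mulr0.
have [c hc] : exists c, forall w : 'rV[K]_3, \sum_j (w *m A) 0 j ^+ d = c * \sum_i w 0 i ^+ d.
  pose lq : 3.-tuple {mpoly K[3]} := [tuple h i | i < 3].
  have hlq i : tnth lq i \is 1.-homog by rewrite tnth_mktuple.
  have hP := dhomog_comp (fermat_homog K d) hlq; rewrite mul1n in hP.
  have P0 : mmap f xi (F \mPo lq) = 0.
    rewrite mmap_comp mmap_fermat !tnth_mktuple; case: (hh 0) => _ <-; case: (hh 1) => _ <-.
    case: (hh 2) => _ <-; rewrite !exprMn -!mulrDl selfmap_fermat ?mul0r //; by case: hts.
  have [c hc] := form_degree_d d_gt2 ch hP P0; exists c => w.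
  have := congr1 (meval (w 0)) hc; rewrite mevalZ comp_mpoly_meval !meval_fermat !sum3 => <-.
  have wA j : (w *m A) 0 j = (tnth lq j).@[w 0].
    rewrite tnth_mktuple /meval hE mxE; apply: eq_bigr => k _; exact: mulrC.
  by rewrite !wA.
have [s hs] := fermat_automorphism_monomial charK d_gt2 uA hc.
have vEs j : val tau j * J = f (A (s j) j) * xi (s j).
  rewrite vE (bigD1 (s j)) //= big1 ?addr0 // => k ks.
  by case: (hs j) => _ -> //; rewrite rmorph0 mul0r.
have As j : A (s j) j != 0.
  have : val tau j * J != 0 by rewrite mulf_neq0.
  by rewrite vEs; apply: contraNneq => ->; rewrite rmorph0 mul0r.
(* The nonzero entries of [A] have the same d-th power, so division by one of them leaves d-th roots
   of unity. *)
exists s, (fun j => A (s j) j / A (s 0) 0).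
have ha j : (A (s j) j / A (s 0) 0) ^+ d = 1.
  rewrite expr_div_n; case: (hs j) => -> _; case: (hs 0) => h0 _; rewrite -h0 divff //.
  exact: expf_neq0.
split=> //; apply/rat_eq_scaleP; split; [by case: hts => -[] | exact: monomial_ratmap |].
exists (f (A (s 0) 0) / J); first by rewrite mulf_neq0 ?invr_eq0 ?fmorph_eq0.
move=> j; rewrite monomial_value; apply: (mulIf J0); rewrite vEs fmorph_div.
by field; rewrite J0 fmorph_eq0 As.
Qed.

End MonomialMaps.

(** * Generators *)

Lemma sum_distinct3 (V : nmodType) (i j k : 'I_3) (G : 'I_3 -> V) :
  i != j -> k != i -> k != j -> \sum_r G r = G i + G j + G k.
Proof.
move=> ij ki kj; rewrite (bigD1 i) //= (bigD1 j) 1?eq_sym //= (bigD1 k) ?ki //= big1 ?addr0 ?addrA //.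
move=> r /andP[/andP[ri rj] rk]; move: ij ki kj ri rj rk.
by move: i j k r; do 4!apply: ord3P.
Qed.

Lemma third_index (i j : 'I_3) : exists k : 'I_3, k != i /\ k != j.
Proof. by move: i j; do 2!apply: ord3P; (by exists 0) || (by exists 1) || (by exists 2). Qed.

Section Generation.
Variables (K : closedFieldType) (charK : [pchar K] =i pred0) (L : fieldType).
Variables (f : {rmorphism K -> L}) (d : nat) (d_gt3 : (3 < d)%N) (x y : L) (D : L -> L).
Hypotheses (ch : fermat_chart f d x y) (hD : fermat_derivation f d x y D).
Local Notation xi := (generic_point x y).
Local Notation F := (fermat K d).
Local Notation val := (generic_value f x y).

Let d_gt2 : (2 < d)%N. Proof. by apply: leq_trans d_gt3. Qed.
Let d_gt1 : (1 < d)%N. Proof. by apply: leq_trans d_gt3. Qed.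
Let d_gt0 : (0 < d)%N. Proof. exact: ltnW. Qed.

Let ratmapP := (@is_ratmapP _ charK _ _ _ d_gt1 _ _ ch).
Let rateqP := (@rat_eqP _ charK _ _ _ d_gt1 _ _ ch).
Let rateq_scaleP := (@rat_eq_scaleP _ charK _ _ _ d_gt3 _ _ ch).
Let xi0 := generic_point_neq0 d_gt3 ch.

Lemma linear_map_value (A : 'M[K]_(3, 2)) j : val (linear_map A) j = \sum_i f (A i j) * xi i.
Proof.
rewrite /generic_value tnth_mktuple raddf_sum; apply: eq_bigr => i _.
by rewrite /= mmapZ mmapX mmap1U.
Qed.

Lemma linear_map_homog (A : 'M[K]_(3, 2)) j : tnth (linear_map A) j \is 1.-homog.
Proof. by rewrite tnth_mktuple; apply: rpred_sum => i _; rewrite rpredZ // homogX. Qed.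

Lemma linear_map_ratmap (A : 'M[K]_(3, 2)) : \rank A = 2 -> is_ratmap F (linear_map A).
Proof.
move=> rA; apply/ratmapP; split; first by exists 1%N; apply: linear_map_homog.
apply: NNPP => hno; have A0 : A = 0.
  apply/matrixP => i j; rewrite mxE.
  have z : tnth (linear_map A) j = 0.
    apply: (mmap_generic_eq0 ch (linear_map_homog A j) d_gt1); apply/eqP.
    by apply: contraT => h; case: hno; exists j.
  have := congr1 (mcoeff U_(i)) z; rewrite mcoeff0 tnth_mktuple raddf_sum (bigD1 i) //= big1 ?addr0.
    by rewrite mcoeffZ mcoeffXU eqxx mulr1.
  by move=> k ki; rewrite mcoeffZ mcoeffXU (negPf ki) mulr0.
by move: rA; rewrite A0 mxrank0.
Qed.

Lemma galois_at_monomial (P : 'rV[K]_3) (s : {perm 'I_3}) (a : 'I_3 -> K) : (forall j, a j ^+ d = 1) ->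
  (forall A, is_projection_from P A -> forall l,
     \sum_i f (A i l) * (f (a i) * xi (s i)) = \sum_i f (A i l) * xi i) ->
  galois_at F P (monomial_map s a).
Proof.
move=> ha hP; split.
  have ha' := unity_inverseP s ha.
  have hr := rat_eq_refl charK d_gt3 ch (monomial_ratmap charK d_gt3 ch s ha).
  have [h1 h2] := rat_comp_monomial_inverse charK d_gt3 ch ha hr.
  exists (monomial_map s^-1%g (unity_inverse s a)); split=> //.
    exact: (monomial_selfmap charK d_gt3 ch).
  exact: (monomial_selfmap charK d_gt3 ch).
move=> A hA; have hm := linear_map_ratmap (proj1 hA).
have vE l : val (rat_comp (linear_map A) (monomial_map s a)) l = val (linear_map A) l.
  rewrite generic_value_comp linear_map_value -(hP A hA) tnth_mktuple raddf_sum; apply: eq_bigr => i _.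
  by rewrite /= mmapZ mmapX mmap1U monomial_value.
apply/rateq_scaleP; split=> //; last by exists 1; rewrite ?oner_neq0 // => l; rewrite vE mul1r.
have /ratmapP [_ [l hl]] := hm; apply/ratmapP; split; last by exists l; rewrite vE.
by exists 1%N => j; rewrite tnth_mktuple; apply: (dhomog_comp (linear_map_homog A j) (monomial_homog s a)).
Qed.

(** Equality of the two maps to the projective line is a quadratic identity at the generic point. As
    2 < d, it holds between polynomials and can be tested on any vector [w]. *)
Lemma galois_at_equation (P : 'rV[K]_3) A tau : galois_at F P tau -> is_projection_from P A ->
  exists (s : {perm 'I_3}) (a : 'I_3 -> K), [/\ forall j, a j ^+ d = 1, rat_eq F tau (monomial_map s a) &
    forall (w : 'I_3 -> K) l l',
      (\sum_i A i l * (a i * w (s i))) * (\sum_i A i l' * w i)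
      = (\sum_i A i l' * (a i * w (s i))) * (\sum_i A i l * w i)].
Proof.
move=> [hB hG] hA; have [s [a [ha ht]]] := birational_monomial charK d_gt3 ch hD hB.
exists s, a; split=> // w l l'; have /rateqP [_ _ hpar] := hG A hA.
have /rateq_scaleP [_ _ [c c0 hc]] := ht.
pose P1 l : {mpoly K[3]} := \sum_i (A i l * a i) *: 'X_(s i).
pose P2 l : {mpoly K[3]} := \sum_i A i l *: 'X_i.
have P1E (S : comNzRingType) (g : {rmorphism K -> S}) v l0 :
    mmap g v (P1 l0) = \sum_i g (A i l0) * (g (a i) * v (s i)).
  by rewrite raddf_sum; apply: eq_bigr => i _; rewrite /= mmapZ mmapX mmap1U rmorphM mulrA.
have P2E (S : comNzRingType) (g : {rmorphism K -> S}) v l0 :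
    mmap g v (P2 l0) = \sum_i g (A i l0) * v i.
  by rewrite raddf_sum; apply: eq_bigr => i _; rewrite /= mmapZ mmapX mmap1U.
have P1h l0 : P1 l0 \is 1.-homog by apply: rpred_sum => i _; rewrite rpredZ // homogX.
have P2h l0 : P2 l0 \is 1.-homog by apply: rpred_sum => i _; rewrite rpredZ // homogX.
have hom2 : P1 l * P2 l' - P1 l' * P2 l \is 2.-homog.
  by rewrite rpredB // -[2%N]/(1 + 1)%N dhomogM.
have vE l0 : val (rat_comp (linear_map A) tau) l0 = c * mmap f xi (P1 l0).
  rewrite generic_value_comp tnth_mktuple raddf_sum P1E mulr_sumr; apply: eq_bigr => i _.
  by rewrite /= mmapZ mmapX mmap1U hc monomial_value; ring.
have z : P1 l * P2 l' - P1 l' * P2 l = 0.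
  apply: (mmap_generic_eq0 ch hom2 d_gt2); rewrite mmapB !rmorphM /=.
  have := hpar l l'; rewrite !vE !linear_map_value -!(P2E _ f) -!mulrA => /(mulfI c0) ->.
  by rewrite subrr.
have := congr1 (meval w) z; rewrite mevalB !mevalM meval0 => /eqP; rewrite subr_eq0 => /eqP.
by rewrite /meval !P1E !P2E.
Qed.

(** * Galois groups at the vertices of the coordinate triangle *)

Definition homology i (c : K) (j : 'I_3) : K := if j == i then c else 1.

Lemma homology_unity i c : c ^+ d = 1 -> forall j, homology i c j ^+ d = 1.
Proof. by move=> hc j; rewrite /homology; case: eqP => // _; rewrite expr1n. Qed.

Local Notation e i := (delta_mx 0 i : 'rV[K]_3).

Lemma homology_galois i c : c ^+ d = 1 -> galois_at F (e i) (monomial_map 1%g (homology i c)).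
Proof.
move=> hc; apply: galois_at_monomial; first exact: homology_unity.
move=> A [_ hA] l; apply: eq_bigr => r _; rewrite perm1 /homology.
have [->|_] := eqVneq r i; last by rewrite rmorph1 mul1r.
by move/rowP/(_ l): hA; rewrite -rowE !mxE => ->; rewrite rmorph0 !mul0r.
Qed.

(** The projection from e_i forgets coordinate i, so [tau] must preserve the ratio of the two other
    coordinates at every test vector. *)
Lemma galois_homology i tau : galois_at F (e i) tau ->
  exists2 c, c ^+ d = 1 & rat_eq F tau (monomial_map 1%g (homology i c)).
Proof.
move=> hG; pose A : 'M[K]_(3, 2) := \matrix_(r, l) (r == lift i l)%:R.
have hA : is_projection_from (e i) A.
  split; last by apply/rowP => l; rewrite -rowE !mxE (negPf (neq_lift i l)).
  have AA : A^T *m A = 1%:M.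
    apply/matrixP => l l'; rewrite !mxE (bigD1 (lift i l)) //= !mxE eqxx mul1r big1 ?addr0.
      by rewrite (inj_eq lift_inj).
    by move=> r rl; rewrite !mxE (negPf rl) mul0r.
  by apply/eqP; rewrite eqn_leq rank_leq_col /= -[X in (X <= _)%N](mxrank1 K) -AA mxrankM_maxr.
have [s [a [ha ht hw]]] := galois_at_equation hG hA.
have a0 j : a j != 0 := unity_neq0 d_gt3 (ha j).
have eqn (w : 'I_3 -> K) p q : p != i -> q != i -> a p * w (s p) * w q = a q * w (s q) * w p.
  rewrite ![_ == i]eq_sym => /unlift_some [l -> _] /unlift_some [l' -> _].
  have sumA l0 (G : 'I_3 -> K) : \sum_r A r l0 * G r = G (lift i l0).
    rewrite (bigD1 (lift i l0)) //= !mxE eqxx mul1r big1 ?addr0 // => r rl.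
    by rewrite mxE (negPf rl) mul0r.
  by have := hw w l l'; rewrite !sumA.
have sq q : q != i -> s q = q.
  move=> qi; have [p [pi pq]] := third_index i q.
  (* For the vector that is zero exactly at [q] the left side vanishes, while the right side would
     be a_q if s moved [q]. *)
  have := eqn (fun r => (r != q)%:R) p q pi qi; rewrite eqxx pq mulr0 mulr1 => /esym/eqP.
  have [//|h] := eqVneq (s q) q.
  by rewrite /= mulr1 (negPf (a0 q)).
have s1 : s = 1%g.
  apply/permP => r; rewrite perm1; have [->|ri] := eqVneq r i; last exact: sq.
  by have [//|si] := eqVneq (s i) i; apply: (@perm_inj _ s); apply: sq.
have [q0 [q0i _]] := third_index i i.
have aq q : q != i -> a q = a q0.
  (* The all-ones vector shows that the coefficients other than a_i agree; dividing by their common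
     value leaves a homology. *)
  by move=> qi; have := eqn (fun=> 1) q q0 qi q0i; rewrite !mulr1.
exists (a i / a q0); first by rewrite expr_div_n !ha divr1.
apply: (rat_eq_trans charK d_gt3 ch ht); rewrite s1; apply/rateq_scaleP.
split; try exact: (monomial_ratmap charK d_gt3 ch).
  by apply: (monomial_ratmap charK d_gt3 ch); apply: homology_unity; rewrite expr_div_n !ha divr1.
exists (f (a q0)); first by rewrite fmorph_eq0.
move=> r; rewrite !monomial_value mulrA -rmorphM /homology; congr (f _ * _).
by have [->|/aq ->] := eqVneq r i; rewrite ?mulr1 // mulrC divfK.
Qed.

Lemma has_card_quasi_galois P n : (1 < n)%N -> has_card F (galois_at F P) n -> quasi_galois F P.
Proof.
move=> n1 [g [h1 h2 _]]; exists (fun i => g (widen_ord n1 i)); split=> // i j /h2 /(congr1 (@nat_of_ord _)) hij.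
by apply: val_inj.
Qed.

Lemma delta_neq0 i : e i != 0.
Proof. by apply/eqP => /rowP/(_ i); rewrite !mxE !eqxx; apply/eqP/oner_neq0. Qed.

Lemma homology_G i c : c ^+ d = 1 -> G_curve F d (monomial_map 1%g (homology i c)).
Proof.
move=> hc; apply: gen_in; exists (e i).
have [|r [sr ur mr]] := XnsubC_roots charK d_gt0 (a := 1); first exact: oner_neq0.
have rP (k : 'I_d) : (nth 0 r k) ^+ d = 1 by apply/eqP; rewrite -mr mem_nth // sr.
have card : has_card F (galois_at F (e i)) d.
  exists (fun k => monomial_map 1%g (homology i (nth 0 r k))); split.
  - by move=> k; apply: homology_galois.
  - move=> k k' /rateqP [_ _ h]; apply: val_inj; apply/eqP; rewrite /= -(nth_uniq 0 _ _ ur) ?sr //.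
    have [j [ji _]] := third_index i i.
    have := h i j; rewrite !monomial_value !perm1 /homology eqxx (negPf ji) !rmorph1 !mul1r.
    move=> hk; apply/eqP/(fmorph_inj f)/(mulIf (mulf_neq0 (xi0 i) (xi0 j))).
    by rewrite mulrA hk; ring.
  - move=> t /galois_homology [c' hc' ht].
    have cr : c' \in r by rewrite mr hc'.
    have ir : (index c' r < d)%N by rewrite -sr index_mem.
    by exists (Ordinal ir); rewrite /= nth_index.
split=> //; [exact: delta_neq0 | exact: has_card_quasi_galois card | exact: homology_galois].
Qed.

(** * Galois groups at the points e_i - e_j *)

Local Notation swap i j := (@monomial_map K (tperm i j) (fun=> 1)).

Lemma one_unity (j : 'I_3) : (1 : K) ^+ d = 1. Proof. exact: expr1n. Qed.

Lemma swap_galois i j : galois_at F (e i - e j) (swap i j).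
Proof.
apply: galois_at_monomial; first exact: one_unity.
move=> A [_ hA] l; rewrite [RHS](reindex_inj (@perm_inj _ (tperm i j))) /=.
apply: eq_bigr => r _; rewrite rmorph1 mul1r; congr (f _ * _).
have Aij : A i l = A j l.
  by move/rowP/(_ l): hA; rewrite mulmxBl -!rowE !mxE => /eqP; rewrite subr_eq0 => /eqP.
by case: tpermP => [->|->|].
Qed.

Lemma id_galois P : galois_at F P (monomial_map 1%g (fun=> 1)).
Proof.
apply: galois_at_monomial; first exact: one_unity.
by move=> A _ l; apply: eq_bigr => r _; rewrite rmorph1 mul1r perm1.
Qed.

Lemma monomial_const tau s b (a : 'I_3 -> K) : b ^+ d = 1 -> (forall j, a j = b) ->
  rat_eq F tau (monomial_map s a) -> rat_eq F tau (monomial_map s (fun=> 1)).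
Proof.
move=> hb ha ht; apply: (rat_eq_trans charK d_gt3 ch ht); apply/rateq_scaleP.
split; try by apply: (monomial_ratmap charK d_gt3 ch) => j; rewrite ?ha ?expr1n.
exists (f b); first by rewrite fmorph_eq0 (unity_neq0 d_gt3 hb).
by move=> j; rewrite !monomial_value ha rmorph1 mul1r.
Qed.

(** The forms X_i + X_j and X_k are coordinates on the lines through e_i - e_j. Preserving their
    ratio forces s to fix k, and then the three coefficients to be equal. *)
Lemma galois_swap i j tau : i != j -> galois_at F (e i - e j) tau ->
  rat_eq F tau (monomial_map 1%g (fun=> 1)) \/ rat_eq F tau (swap i j).
Proof.
move=> ij hG; have [k [ki kj]] := third_index i j.
pose A : 'M[K]_(3, 2) := \matrix_(r, l) (if l == 0 then r != k else r == k)%:R.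
(* A left inverse of [A], which certifies rank 2. *)
pose B : 'M[K]_(2, 3) := \matrix_(l, r) (if l == 0 then r == i else r == k)%:R.
have sumA (G : 'I_3 -> K) : \sum_r A r 0 * G r = G i + G j /\ \sum_r A r 1 * G r = G k.
  rewrite !(sum_distinct3 _ ij ki kj) !mxE /= eqxx ![i == k]eq_sym ![j == k]eq_sym.
  by rewrite (negPf ki) (negPf kj) /= !mul0r !mul1r !addr0 !add0r.
have hA : is_projection_from (e i - e j) A.
  split; last first.
    rewrite mulmxBl -!rowE; apply/rowP => l; rewrite !mxE.
    by case: ifP => _; rewrite ![_ == k]eq_sym (negPf ki) (negPf kj) subrr.
  have BA : B *m A = 1%:M.
    apply/matrixP => l l'; rewrite !mxE (sum_distinct3 _ ij ki kj) !mxE !eqxx.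
    rewrite ![i == k]eq_sym ![j == k]eq_sym ![j == i]eq_sym (negPf ki) (negPf kj) (negPf ij).
    by case: l => [[|[|//]] hl]; case: l' => [[|[|//]] hl'];
      rewrite -!val_eqE /= ?mulr0 ?mulr1 ?mul0r ?addr0 ?add0r.
  by apply/eqP; rewrite eqn_leq rank_leq_col /= -[X in (X <= _)%N](mxrank1 K) -BA mxrankM_maxr.
have [s [a [ha ht hw]]] := galois_at_equation hG hA.
have a0 r : a r != 0 := unity_neq0 d_gt3 (ha r).
have eqn (w : 'I_3 -> K) : (a i * w (s i) + a j * w (s j)) * w k = a k * w (s k) * (w i + w j).
  have := hw w 0 1; have [-> ->] := sumA (fun r => a r * w (s r)).
  by have [-> ->] := sumA w.
have sk : s k = k.
  (* For the vector that is zero exactly at k the left side vanishes, while the right side would be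
     2 a_k if s moved k. *)
  have := eqn (fun r => (r != k)%:R).
  rewrite eqxx mulr0 ![i == k]eq_sym ![j == k]eq_sym ki kj => /esym/eqP.
  have [//|h] := eqVneq (s k) k; rewrite /= mulr1 mulf_eq0 (negPf (a0 k)) /=.
  by rewrite -(natrD K 1 1) (negPf (natr_neq0_pchar0 charK _)).
have eqn' (w : 'I_3 -> K) : w k = 1 -> a i * w (s i) + a j * w (s j) = a k * (w i + w j).
  by move=> wk; have := eqn w; rewrite sk wk !mulr1.
have only r : r = i \/ r = j \/ r = k.
  move: ij ki kj; clear; move: i j k r; do 4!apply: ord3P => //; by intuition.
have sik : s i != k by rewrite -[X in _ != X]sk (inj_eq (@perm_inj _ s)) eq_sym.
have sjk : s j != k by rewrite -[X in _ != X]sk (inj_eq (@perm_inj _ s)) eq_sym.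
have sij : s i != s j by rewrite (inj_eq (@perm_inj _ s)).
(* Whether s fixes or exchanges i and j, the vectors vanishing only at j and only at i give, in one
   order or the other, a_i = a_k and a_j = a_k. *)
have ei := eqn' (fun r => (r != j)%:R); have ej := eqn' (fun r => (r != i)%:R).
have {}ei : a i * (s i != j)%:R + a j * (s j != j)%:R = a k by rewrite ei ?kj // eqxx ij addr0 mulr1.
have {}ej : a i * (s i != i)%:R + a j * (s j != i)%:R = a k.
  by rewrite ej ?ki // eqxx [j == i]eq_sym ij add0r mulr1.
have const : a i = a k -> a j = a k -> forall r, a r = a k.
  by move=> h1 h2 r; case: (only r) => [->|[->|->]].
case: (only (s i)) => [si|[si|si]]; last by rewrite si eqxx in sik.
  have sj : s j = j.
    by case: (only (s j)) => [h|[//|h]]; [rewrite si h eqxx in sij | rewrite h eqxx in sjk].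
  left; rewrite si sj !eqxx ij [j == i]eq_sym (negPf ij) /= !(mulr0, mulr1, addr0, add0r) in ei ej.
  have -> : 1%g = s by apply/permP => r; rewrite perm1; case: (only r) => [->|[->|->]].
  exact: monomial_const (ha k) (const ei ej) ht.
have sj : s j = i.
  by case: (only (s j)) => [//|[h|h]]; [rewrite si h eqxx in sij | rewrite h eqxx in sjk].
right; rewrite si sj !eqxx ij [j == i]eq_sym (negPf ij) /= !(mulr0, mulr1, addr0, add0r) in ei ej.
have -> : tperm i j = s.
  by apply/permP => r; case: (only r) => [->|[->|->]]; rewrite ?tpermL ?tpermR ?tpermD // eq_sym.
exact: monomial_const (ha k) (const ej ei) ht.
Qed.

(** The group has order exactly 2: the exchange differs from the identity because X_i - X_j is
    nonzero at the generic point. *)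
Lemma swap_G i j : i != j -> G_curve F 2 (swap i j).
Proof.
move=> ij; apply: gen_in; exists (e i - e j).
have [k [ki kj]] := third_index i j.
have card : has_card F (galois_at F (e i - e j)) 2.
  exists (fun l : 'I_2 => if l == 0 then monomial_map 1%g (fun=> 1) else swap i j); split.
  - by move=> l; case: ifP => _; [apply: id_galois | apply: swap_galois].
  - have ne : ~ rat_eq F (monomial_map 1%g (fun=> 1)) (swap i j).
      move=> /rateqP [_ _ /(_ i k)]; rewrite !monomial_value !perm1 tpermL tpermD 1?eq_sym // !rmorph1 !mul1r.
      rewrite mulrC => /(mulfI (xi0 k)) h.
      have h1 : ('X_i - 'X_j : {mpoly K[3]}) \is 1.-homog by rewrite rpredB // homogX.
      have h0 : ('X_i - 'X_j : {mpoly K[3]}) = 0.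
        by apply: (mmap_generic_eq0 ch h1 d_gt1); rewrite mmapB !mmapX !mmap1U h subrr.
      have := congr1 (meval (fun r => (r == i)%:R)) h0.
      rewrite mevalB !mevalXU meval0 eqxx eq_sym (negPf ij) subr0; apply/eqP/oner_neq0.
    by move=> [[|[|//]] h] [[|[|//]] h'] /= hh; apply: val_inj => //=; case: ne => //; apply: (rat_eq_sym charK d_gt3 ch).
  - by move=> t /(galois_swap ij) [ht|ht]; [exists 0 | exists 1].
split=> //; [| exact: has_card_quasi_galois card | exact: swap_galois].
apply/eqP => /rowP/(_ i); rewrite !mxE !eqxx (negPf ij) subr0; apply/eqP/oner_neq0.
Qed.

(** * Generation of the automorphism group *)

Local Notation G2d := (fun sigma => G_curve F 2 sigma \/ G_curve F d sigma).

(** A monomial map is a permutation of coordinates, hence a product of transpositions, composed with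
    three homologies. *)
Lemma monomial_generated s (a : 'I_3 -> K) : (forall j, a j ^+ d = 1) ->
  generated F G2d (monomial_map s a).
Proof.
move=> ha; have gperm (t : {perm 'I_3}) : generated F G2d (monomial_map t (fun=> 1)).
  have [ts -> hts] := prod_tpermP t.
  elim: ts hts => [_|[i j] ts IH /= /andP[ij hts]].
    by rewrite big_nil monomial_id; apply: gen_id.
  rewrite big_cons /=; move: (\prod_(t <- ts) _)%g (IH hts) => q hq.
  have <- : rat_comp (swap i j) (@monomial_map K q (fun=> 1)) = monomial_map (tperm i j * q)%g (fun=> 1).
    by rewrite monomial_comp; apply: eq_monomial => r; rewrite mulr1.
  by apply: gen_comp => //; apply: gen_in; left; apply: swap_G.
(* In a composite the coefficient of the inner map is read at s j, which the shift by the inverse of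
   s compensates. *)
pose b j := a (s^-1%g j).
have <- : rat_comp (monomial_map s (fun=> 1)) (rat_comp (monomial_map 1%g (homology 0 (b 0)))
    (rat_comp (monomial_map 1%g (homology 1 (b 1))) (monomial_map 1%g (homology 2 (b 2)))))
    = monomial_map s a.
  rewrite !monomial_comp !mulg1; apply: eq_monomial => j; rewrite !perm1 mul1r -[in RHS](permK s j).
  by rewrite -/(b _); move: (s j); apply: ord3P; rewrite /homology /= ?mulr1 ?mul1r.
apply: gen_comp; first exact: gperm.
by do 2?[apply: gen_comp]; apply: gen_in; right; apply: homology_G; rewrite ha.
Qed.

Definition is_monomial tau := exists (s : {perm 'I_3}) (a : 'I_3 -> K),
  (forall j, a j ^+ d = 1) /\ rat_eq F tau (monomial_map s a).

(** For an inverse it suffices that it is birational, since every birational self-map is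
    monomial. *)
Lemma generated_monomial S tau : (forall t, S t -> is_monomial t) ->
  generated F S tau -> is_monomial tau.
Proof.
move=> hS; elim=> {tau} [t /hS //||t u _ [s [a [ha ht]]] _ [s' [b [hb hu]]]|t u _ _ htu|t u _ [s [a [ha ht]]] htu].
- exists 1%g, (fun=> 1); split; first exact: one_unity.
  rewrite -monomial_id; apply: (rat_eq_refl charK d_gt3 ch); apply: (monomial_ratmap charK d_gt3 ch).
  exact: one_unity.
- exists (s * s')%g, (fun j => a j * b (s j)); split; last exact: (rat_comp_monomial charK d_gt3 ch).
  by move=> j; rewrite exprMn ha hb mulr1.
- apply: (birational_monomial charK d_gt3 ch hD); exists t.
  by case: htu => h1 h2 h3 h4; split.
- exists s, a; split=> //; apply: (rat_eq_trans charK d_gt3 ch _ ht).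
  exact: (rat_eq_sym charK d_gt3 ch).
Qed.

Lemma G_curve_monomial n tau : G_curve F n tau -> is_monomial tau.
Proof.
apply: generated_monomial => t [P [_ _ _ [hB _]]].
exact: (birational_monomial charK d_gt3 ch hD).
Qed.

(** Both sides consist of the maps equal to a monomial one with d-th roots of unity as coefficients;
    such maps are regular and so are their inverses. *)
Lemma generated_iff_Aut tau : generated F G2d tau <-> Aut_curve F tau.
Proof.
split.
  move=> /(@generated_monomial _ tau) [t [/G_curve_monomial|/G_curve_monomial]//|s [a [ha ht]]].
  exact: (monomial_Aut charK d_gt3 ch ha ht).
move=> [sigma [hts _ _]].
have [|s [a [ha ht]]] := birational_monomial charK d_gt3 ch hD (tau := tau); first by exists sigma.
apply: (gen_eq _ (rat_eq_sym charK d_gt3 ch ht)); exact: monomial_generated.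
Qed.

End Generation.

Theorem theorem5p4 (K : closedFieldType) (charK : [pchar K] =i pred0)
    (d : nat) (hd : (4 <= d)%N) (tau : 3.-tuple {mpoly K[3]}) :
  generated (fermat K d)
    (fun sigma => G_curve (fermat K d) 2 sigma \/ G_curve (fermat K d) d sigma) tau
  <-> Aut_curve (fermat K d) tau.
Proof.
have d1 : (1 < d)%N by apply: leq_trans hd.
have [L [f [x [y ch]]]] := fermat_chart_exists charK (ltnW d1).
have [D [D1 D2 D3 D4]] := fermat_derivation_exists d1 ch.
exact: (generated_iff_Aut charK hd ch (FermatDerivation D1 D2 D3 D4)).
Qed.
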